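(* Let $\beta\in(1,2]$ be a multinacci number. Then $$\mathcal B_\beta=\mathcal E_\beta=\left[0,1-\frac1\beta\right)\setminus\bigcup[t_L,t_R)=\left\{t\in[0,1):\ \lim_{r\to0}\dim_H\bigl(\mathcal B_\beta\cap(t,t+r)\bigr)=\dim_H K_\beta(t)>0\right\},$$ where the union is taken over all $\beta$-Lyndon intervals $[t_L,t_R)$, which are pairwise disjoint (and the limit is over $r>0$).
   Context: For $\beta\in(1,2]$ let $T_\beta:[0,1)\to[0,1)$, $T_\beta(x)=\beta x \pmod 1$. For $t\in[0,1)$ let $$K_\beta(t)=\{x\in[0,1): T_\beta^n(x)\ge t\ \text{ for all } n\ge 0\}.$$ $\dim_H$ denotes Hausdorff dimension, with $\dim_H\emptyset=0$. The set-valued bifurcation set and the dimension bifurcation set are $$\mathcal E_\beta=\{t\in[0,1): K_\beta(t')\neq K_\beta(t)\ \text{ for all } t'\in(t,1)\},$$ $$\mathcal B_\beta=\{t\in[0,1): \dim_H K_\beta(t')\neq \dim_H K_\beta(t)\ \text{ for all } t'\in(t,1)\}.$$ A number $\beta$ is multinacci if for some integer $m\ge1$ it is the unique root in $(1,2)$ of $x^{m+1}=x^m+x^{m-1}+\cdots+x+1$. The quasi-greedy $\beta$-expansion of $1$, denoted $\delta(\beta)$, is the lexicographically largest sequence $(d_i)_{i\ge1}\in\{0,1\}^{\mathbb N}$ not ending with $0^\infty$ such that $\sum_{i\ge1} d_i\beta^{-i}=1$. Here $\sigma$ is the left shift on $\{0,1\}^{\mathbb N}$, $\mathbf c^\infty=\mathbf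 c\mathbf c\cdots$ for a word $\mathbf c$, and $\prec,\succ$ denote the strict lexicographic order on sequences and on words of equal length. A word $s_1\ldots s_p\in\{0,1\}^p$ ($p\ge1$) is $\beta$-Lyndon if $s_{i+1}\ldots s_p\succ s_1\ldots s_{p-i}$ for all $1\le i<p$, and $\sigma^n((s_1\ldots s_p)^\infty)\prec\delta(\beta)$ for all $n\ge0$. An interval $[t_L,t_R)\subset[0,1)$ is a $\beta$-Lyndon interval if there is a $\beta$-Lyndon word $s_1\ldots s_p$ with $t_L=\sum_{i=1}^p s_i\beta^{-i}$ and $t_R=\frac{\beta^p}{\beta^p-1}\,t_L$. (The word $0$ gives the empty interval $[0,0)$.) *)

(* Defs.v *)
From HB Require Import structures.
From mathcomp Require Import all_boot all_order all_algebra.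
From mathcomp Require Import all_classical all_reals all_analysis.

Set Implicit Arguments.
Unset Strict Implicit.
Unset Printing Implicit Defensive.

Import Order.TTheory GRing.Theory Num.Theory.
Import numFieldNormedType.Exports.

Local Open Scope classical_set_scope.
Local Open Scope ring_scope.

Section Hausdorff.
Context {R : realType}.
Implicit Types (A U : set R) (s delta : R).

(* [diam set0] is [-oo]. *)
Definition diam U : \bar R :=
  ereal_sup [set `|p.1 - p.2|%:E | p in U `*` U].

(* The empty set counts for 0 in a cover for every [s], while a singleton
   counts for [0 `^ 0 = 1] when [s = 0]. *)
Definition diam_pow s U : \bar R :=
  if U == set0 then 0%E else poweR (diam U) s.

Definition hausdorff_content s delta A : \bar R :=
  ereal_inf [set (\sum_(0 <= i <oo) diam_pow s (U i))%E |
    U in [set U : (set R)^nat |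
      A `<=` \bigcup_i U i /\ forall i, (diam (U i) <= delta%:E)%E]].

Definition hausdorff_measure s A : \bar R :=
  ereal_sup [set hausdorff_content s delta A | delta in [set d : R | 0 < d]].

Definition hausdorff_dim A : \bar R :=
  ereal_inf [set s%:E | s in [set s : R | 0 <= s /\ hausdorff_measure s A = 0%E]].

End Hausdorff.

Section Sequences.

(* Binary sequences are indexed from 0: [d i] is the digit written d_(i+1). *)
Definition seq_shift (n : nat) (d : nat -> bool) : nat -> bool :=
  fun i => d (n + i)%N.

Definition seq_lt (c d : nat -> bool) : Prop :=
  exists2 n, (forall i, (i < n)%N -> c i = d i) & ~~ c n && d n.

(* Only meaningful for [s] nonempty. *)
Definition word_periodic (s : seq bool) : nat -> bool :=
  fun i => nth false s (i %% size s).

End Sequences.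

Section BetaTransformation.
Context {R : realType}.
Implicit Types (beta t x : R).

Definition beta_transform beta x : R := beta * x - (Num.floor (beta * x))%:~R.

Definition survivor beta t : set R :=
  [set x | 0 <= x < 1 /\ forall n, t <= iter n (beta_transform beta) x].

Definition bif_set beta : set R :=
  [set t | 0 <= t < 1 /\ forall t', t < t' < 1 -> survivor beta t' <> survivor beta t].

Definition bif_dim beta : set R :=
  [set t | 0 <= t < 1 /\ forall t', t < t' < 1 ->
    hausdorff_dim (survivor beta t') <> hausdorff_dim (survivor beta t)].

Definition multinacci_root (m : nat) x : Prop :=
  1 < x < 2 /\ x ^+ m.+1 = \sum_(i < m.+1) x ^+ i.

Definition multinacci beta : Prop :=
  exists2 m, (1 <= m)%N &
    multinacci_root m beta /\ forall x, multinacci_root m x -> x = beta.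

Definition infinite_expansion_of_1 beta (d : nat -> bool) : Prop :=
  (forall n, exists2 k, (n <= k)%N & d k) /\
  [series (d i)%:R / beta ^+ i.+1]_i @ \oo --> (1 : R).

(* The maximum exists for every [beta] in (1, 2]; [get] returns a default
   sequence outside that range. *)
Definition quasi_greedy beta : nat -> bool :=
  get [set d | infinite_expansion_of_1 beta d /\
    forall c, infinite_expansion_of_1 beta c -> c = d \/ seq_lt c d].

(* [seqlexi bool] carries the lexicographic order with [false < true]. *)
Definition beta_Lyndon beta (s : seq bool) : Prop :=
  [/\ (0 < size s)%N,
      forall i, (0 < i < size s)%N ->
        ((take (size s - i) s : seqlexi bool) < drop i s)%O &
      forall n, seq_lt (seq_shift n (word_periodic s)) (quasi_greedy beta)].

Definition left_end beta (s : seq bool) : R :=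
  \sum_(i < size s) (nth false s i)%:R / beta ^+ i.+1.

Definition right_end beta (s : seq bool) : R :=
  beta ^+ size s / (beta ^+ size s - 1) * left_end beta s.

Definition Lyndon_intervals beta : set (set R) :=
  [set I : set R | (exists2 s, beta_Lyndon beta s &
              I = `[left_end beta s, right_end beta s[%classic) /\
           I `<=` `[0, 1[ ].

End BetaTransformation.

(* Main.v *)
(* Write [c_j] for the value of [1^j 0^oo] in base [beta]; being multinacci means
   [c_(m+1) = 1], and then a digit word is admissible iff it has no run of
   [m + 1] ones.  One checks that [bif_set] consists of the [t] that never
   return strictly below themselves.  For any other [t] below [1 - 1 / beta],
   the first [p] digits, where [p] is the first time of return below [t], form
   the unique Lyndon word whose interval contains [t].

   For [t] in [bif_set], let [W_n] be the set of words of length [n] that start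
   with 0, have no run of [m + 1] ones, and all of whose suffixes are strictly
   above the digits of [t].  The union [W] of the [W_n] is a monoid, and each word
   occurring in [survivor t] is a run of ones, followed by a word of [W] and a
   prefix of [t]; so the growth rate of [W_n] bounds the dimension of
   [survivor t] from above.  Conversely, raising a late digit 0 of [t] to 1 gives
   a prefix [z] such that [z w_1 w_2 ...], with the [w_i] in [W_n], lies in
   [bif_set], just to the right of [t]; these points form a self-similar Cantor
   set.  Hence [bif_set] has dimension [dim (survivor t)] in every right
   neighbourhood of [t].

   For the strict drop from [t] to [t' > t] in [bif_set], take [v] in [W] with
   [v] below [t'].  The words [u_0 v u_1 v ... u_j], with the [u_i] in the monoid
   [W'] of [t'], are uniquely decodable and belong to [W].  If [W'] had the
   growth rate [lambda] of [W], the sum of [lambda ^ - |u|] over [W'] would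
   diverge, and there would be too many such words. *)

Require Import Defs.
From HB Require Import structures.
From mathcomp Require Import all_boot all_order all_algebra.
From mathcomp Require Import all_classical all_reals all_analysis.
From mathcomp Require Import ring lra zify.
Set Implicit Arguments.
Unset Strict Implicit.
Unset Printing Implicit Defensive.
Import Order.TTheory GRing.Theory Num.Theory.
Import numFieldNormedType.Exports.
Local Open Scope classical_set_scope.
Local Open Scope ring_scope.

(** * Words and digits *)

(* At most [j] leading ones, and no later run of more than [m] ones. *)
Fixpoint bounded_runs (m j : nat) (w : seq bool) : bool :=
  match w with
  | [::] => true
  | true :: w' => if j is j'.+1 then bounded_runs m j' w' else false
  | false :: w' => bounded_runs m m w'
  end.

(* The number of ones that may still follow [w]. *)
Fixpoint run_state (m j : nat) (w : seq bool) : nat :=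
  match w with
  | [::] => j
  | true :: w' => run_state m j.-1 w'
  | false :: w' => run_state m m w'
  end.

Section Runs.
Context (m : nat).
Implicit Types (j : nat) (u v w : seq bool).
Local Notation av := (bounded_runs m).

Lemma bounded_runs_cat j u v :
  av j (u ++ v) = av j u && av (run_state m j u) v.
Proof. by elim: u j => [|[] u IH] [|j] //=. Qed.

Lemma bounded_runs_le i j w : (i <= j)%N -> av i w -> av j w.
Proof. elim: w i j => [|[] w IH] [|i] [|j] //= ij; exact: IH. Qed.

Lemma run_state_le j w : (j <= m)%N -> (run_state m j w <= m)%N.
Proof. by elim: w j => [|[] w IH] [|j] //= jm; apply: IH => //; apply: ltnW. Qed.

Lemma bounded_runs_take k j w : av j w -> av j (take k w).
Proof. by rewrite -{1}(cat_take_drop k w) bounded_runs_cat => /andP[]. Qed.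

Lemma bounded_runs_drop k j w : (j <= m)%N -> av j w -> av m (drop k w).
Proof.
move=> jm; rewrite -{1}(cat_take_drop k w) bounded_runs_cat => /andP[_].
by apply: bounded_runs_le; apply: run_state_le.
Qed.

(** With budget 0, [v] is empty or begins with 0, so no run of ones crosses the junction. *)
Lemma bounded_runs_cat0 j u v : av j u -> av 0 v -> av j (u ++ v).
Proof.
move=> ju v0; rewrite bounded_runs_cat ju /=.
exact: bounded_runs_le v0.
Qed.

Lemma bounded_runs_split j w : av j w ->
  exists2 i, (i <= j)%N & w = nseq i true ++ drop i w /\ av 0 (drop i w).
Proof.
elim: w j => [|[] w IH] [|j] //= h; try by exists 0%N; rewrite // drop0.
- have [i ij [e a]] := IH _ h.
  by exists i.+1 => //=; split=> //; congr cons.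
Qed.

Lemma bounded_runsPn j w : ~~ av j w ->
  (exists v, w = nseq j.+1 true ++ v) \/
  exists u v, w = u ++ nseq m.+1 true ++ v.
Proof.
elim: w j => [|[] w IH] [|j] //=.
- by left; exists w.
- move=> /IH[[v ->]|[u [v ->]]]; first by left; exists v.
  by right; exists (true :: u), v.
all: move=> /IH[[v ->]|[u [v ->]]]; first by right; exists [:: false], v.
all: by right; exists (false :: u), v.
Qed.

Lemma bounded_runs_ones j k : av j (nseq k true) = (k <= j)%N.
Proof. by elim: k j => [|k IH] [|j] //=. Qed.

End Runs.

(** * Inverse branches and itineraries of the beta-transformation *)

Section Branches.
Context (R : realType) (beta : R) (b1 : 1 < beta).
Implicit Types (x y t : R) (w u v : seq bool).

(** The inverse branch of the iterate of order [size w] coded by [w]: an affine contraction of ratio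
    [beta ^- size w]. At [y = 0] it is the value of the finite word [w] in base [beta]. *)
Definition branch w y : R := foldr (fun (b : bool) z => (b%:R + z) / beta) y w.

Let b0 : 0 < beta. Proof. exact: lt_trans b1. Qed.

Lemma branch_cat u v y : branch (u ++ v) y = branch u (branch v y).
Proof. by rewrite /branch foldr_cat. Qed.

Lemma branch_affine w y : branch w y = branch w 0 + y / beta ^+ size w.
Proof.
elim: w => [|b w IH] /=; first by rewrite expr0 divr1 add0r.
by rewrite IH exprS; field; rewrite expf_neq0 // gt_eqF.
Qed.

Lemma ler_branch w : {mono branch w : x y / x <= y}.
Proof.
move=> x y; rewrite (branch_affine w x) (branch_affine w y) lerD2l.
by rewrite ler_pM2r // invr_gt0 exprn_gt0.
Qed.

Lemma ltr_branch w : {mono branch w : x y / x < y}.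
Proof. exact: leW_mono (ler_branch w). Qed.

Lemma branch_ge0 w y : 0 <= y -> 0 <= branch w y.
Proof.
move=> y0; elim: w => [//|b w IH] /=.
by rewrite divr_ge0 ?addr_ge0 ?ler0n // ltW.
Qed.

Lemma branchB w x y : branch w x - branch w y = (x - y) / beta ^+ size w.
Proof.
rewrite (branch_affine w x) (branch_affine w y).
by field; rewrite expf_neq0 // gt_eqF.
Qed.

Lemma norm_branchB w x y :
  `|branch w x - branch w y| = `|x - y| / beta ^+ size w.
Proof.
by rewrite branchB normrM (gtr0_norm (x := _ ^-1)) // invr_gt0 exprn_gt0.
Qed.

Definition digit x : bool := 1 <= beta * x.

Local Notation T := (beta_transform beta).

Fixpoint itinerary (n : nat) x : seq bool :=
  if n is n'.+1 then digit x :: itinerary n' (T x) else [::].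

Lemma size_itinerary n x : size (itinerary n x) = n.
Proof. by elim: n x => //= n IH x; rewrite IH. Qed.

Lemma itineraryD n k x :
  itinerary (n + k) x = itinerary n x ++ itinerary k (iter n T x).
Proof. by elim: n x => //= n IH x; rewrite IH -iterSr. Qed.

Lemma itineraryS n x :
  itinerary n.+1 x = rcons (itinerary n x) (digit (iter n T x)).
Proof. by rewrite -addn1 itineraryD /= cats1. Qed.

Lemma take_itinerary k n x : (k <= n)%N -> take k (itinerary n x) = itinerary k x.
Proof.
move=> kn; rewrite -(subnKC kn) itineraryD take_size_cat // size_itinerary.
by [].
Qed.

Lemma drop_itinerary k n x :
  drop k (itinerary n x) = itinerary (n - k) (iter k T x).
Proof.
have [kn|/ltnW kn] := leqP k n; last first.
  rewrite drop_oversize ?size_itinerary //.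
  by move: kn; rewrite -subn_eq0 => /eqP ->.
by rewrite -{1}(subnKC kn) itineraryD drop_size_cat // size_itinerary.
Qed.

Lemma beta_transform_bounds b x : 0 <= beta_transform b x < 1.
Proof.
rewrite /beta_transform subr_ge0 Num.Theory.ge_floor /=.
by have := Num.Theory.floorD1_gt (b * x); rewrite intrD1 -ltrBlDl.
Qed.

Lemma iter_beta_transform_bounds b n x :
  0 <= x < 1 -> 0 <= iter n (beta_transform b) x < 1.
Proof. by case: n => [|n] //= _; apply: beta_transform_bounds. Qed.

Context (b2 : beta < 2).

Lemma beta_transformE x : 0 <= x < 1 -> T x = beta * x - (digit x)%:R.
Proof.
move=> /andP[x0 x1]; rewrite /beta_transform /digit; congr (_ - _).
have h0 : 0 <= beta * x by rewrite mulr_ge0 // ltW.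
have h2 : beta * x < 2.
  by apply: le_lt_trans b2; rewrite ler_piMr ?ltW.
case: leP => h.
  by rewrite (@Num.Theory.floor_def _ _ 1) //= h //= h2.
by rewrite (@Num.Theory.floor_def _ _ 0) // h0.
Qed.

Lemma branch_digit x : 0 <= x < 1 -> ((digit x)%:R + T x) / beta = x.
Proof. by move=> hx; rewrite beta_transformE //; field; rewrite gt_eqF. Qed.

Lemma branch_itinerary n x : 0 <= x < 1 ->
  branch (itinerary n x) (iter n T x) = x.
Proof.
elim: n x => //= n IH x hx.
by rewrite -iterS iterSr IH ?branch_digit ?beta_transform_bounds.
Qed.

Lemma beta_transform_branch (b : bool) y : 0 <= y < 1 -> (b%:R + y) / beta < 1 ->
  T ((b%:R + y) / beta) = y /\ digit ((b%:R + y) / beta) = b.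
Proof.
move=> /andP[y0 y1] h.
have e : beta * ((b%:R + y) / beta) = b%:R + y.
  by field; rewrite gt_eqF.
have d : digit ((b%:R + y) / beta) = b.
  rewrite /digit e; case: b {h e} => /=; first by rewrite lerDl.
  by rewrite add0r leNgt y1.
split=> //; rewrite beta_transformE ?d; first by rewrite e addrC addKr.
by rewrite h divr_ge0 ?addr_ge0 ?ler0n // ltW.
Qed.

Lemma digit_lt x : digit x = false -> x < 1 / beta.
Proof. by rewrite /digit leNgt => /negbFE; rewrite ltr_pdivlMr // mulrC. Qed.

Lemma digit_ge x : digit x -> 1 / beta <= x.
Proof. by rewrite /digit ler_pdivrMr // mulrC. Qed.

Lemma digit_ge_val x : digit x = (1 / beta <= x).
Proof. by rewrite ler_pdivrMr // mulrC. Qed.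

End Branches.

(** Bernoulli's inequality for the square root of [b] gives linear growth; squaring gives a
    quadratic lower bound for [b ^+ n], which beats every linear function. *)
Lemma linear_lt_exp (R : realType) (b C : R) (N : nat) : 1 < b ->
  exists2 n, (N <= n)%N & C * n.+1%:R < b ^+ n.
Proof.
move=> b1; set r := Num.sqrt b.
have b0 : 0 <= b by rewrite ltW // (lt_trans ltr01).
have r1 : 1 < r by rewrite -sqrtr1 ltr_sqrt ?(lt_trans ltr01).
(* The cap at 1 is for the case [n = 0] of [bern]. *)
pose e := Num.min 1 (r - 1).
have e0 : 0 < e by rewrite lt_min ltr01 subr_gt0.
have bern n : e * n.+1%:R <= r ^+ n.
  elim: n => [|n IH]; first by rewrite mulr1 expr0 ge_min lexx.
  have h1 : e <= r - 1 by rewrite ge_min lexx orbT.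
  have h2 : 1 <= r ^+ n by rewrite exprn_ege1 // ltW.
  rewrite exprS -(natr1 n.+1) mulrDr mulr1.
  have -> : r * r ^+ n = r ^+ n + (r - 1) * r ^+ n by ring.
  by apply: lerD => //; nra.
pose n := (N + Num.Def.trunc (C / (e * e)))%N.
exists n; first exact: leq_addr.
have hn : C < e * e * n.+1%:R.
  rewrite mulrC -ltr_pdivrMr ?mulr_gt0 //.
  apply: lt_le_trans (truncnS_gt _) _.
  by rewrite ler_nat ltnS leq_addl.
have -> : b ^+ n = r ^+ n * r ^+ n by rewrite -exprMn -expr2 sqr_sqrtr.
apply: (@lt_le_trans _ _ ((e * n.+1%:R) * (e * n.+1%:R))).
  have -> : e * n.+1%:R * (e * n.+1%:R) = e * e * n.+1%:R * n.+1%:R by ring.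
  by rewrite ltr_pM2r.
by apply: ler_pM => //; rewrite mulr_ge0 // ltW.
Qed.

(** * Lexicographic comparison of words with the digits of a point *)

Section Compare.
Context (R : realType) (beta : R) (b1 : 1 < beta) (b2 : beta < 2).
Implicit Types (x y t : R) (w u v : seq bool).
Local Notation T := (beta_transform beta).
Local Notation itin := (itinerary beta).
Local Notation dig := (digit beta).
Let b0 : 0 < beta. Proof. exact: lt_trans b1. Qed.

(* [word_gt] and [word_lt] compare [w] with the digits of [t]; both are false when
   these agree on the whole of [w]. *)
Fixpoint word_gt w t : bool :=
  if w is b :: w' then if b == dig t then word_gt w' (T t) else b else false.

Fixpoint word_lt w t : bool :=
  if w is b :: w' then if b == dig t then word_lt w' (T t) else ~~ b else false.

Lemma word_gt_cat u v t : word_gt u t -> word_gt (u ++ v) t.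
Proof. by elim: u t => //= b u IH t; case: ifP => // _; apply: IH. Qed.

Lemma word_lt_cat u v t : word_lt u t -> word_lt (u ++ v) t.
Proof. by elim: u t => //= b u IH t; case: ifP => // _; apply: IH. Qed.

Lemma word_gt_not_lt w t : word_gt w t -> ~~ word_lt w t.
Proof.
elim: w t => //= b w IH t; case: ifP => [_|_ ->] //.
by move=> /IH.
Qed.

Lemma word_cmp w t :
  ~~ word_lt w t -> word_gt w t \/ w = itin (size w) t.
Proof.
elim: w t => /= [|b w IH] t; first by right.
case: eqP => [->|_].
  by move=> /IH[?|e]; [left|right; rewrite {1}e].
by rewrite negbK; left.
Qed.

Lemma word_gt_itinerary_cat n w t :
  word_gt (itin n t ++ w) t = word_gt w (iter n T t).
Proof. by elim: n t => //= n IH t; rewrite eqxx IH -iterSr. Qed.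

Lemma word_gt_itinerary n t : word_gt (itin n t) t = false.
Proof. by rewrite -(cats0 (itin n t)) word_gt_itinerary_cat. Qed.

Lemma digit_le x y : x <= y -> dig x ==> dig y.
Proof.
rewrite /digit => xy; apply/implyP => h; apply: le_trans h _.
by rewrite ler_pM2l.
Qed.

Lemma beta_transform_le x y : 0 <= x < 1 -> 0 <= y < 1 -> dig x = dig y ->
  (T x <= T y) = (x <= y).
Proof.
by move=> hx hy e; rewrite !beta_transformE // e lerD2r ler_pM2l.
Qed.

Lemma word_gt_le w t t' : 0 <= t < 1 -> 0 <= t' < 1 -> t <= t' ->
  word_gt w t' -> word_gt w t.
Proof.
elim: w t t' => //= b w IH t t' ht ht' tt'.
have := digit_le tt'; case: eqP => [->|].
  case: eqP => [e _|].
    by apply: IH; rewrite ?beta_transform_bounds // beta_transform_le.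
  by case: (dig t'); case: (dig t).
by move: b => [] //; case: (dig t'); case: (dig t) => // *.
Qed.

Lemma word_gt_branch w t y : 0 <= t < 1 -> 0 <= y ->
  word_gt w t -> t < branch beta w y.
Proof.
move=> ht y0; elim: w t ht => //= b w IH t ht; case: eqP => [->|+ hb]; last rewrite {}hb => bt.
  move=> /(IH _ (beta_transform_bounds _ _)) h.
  by rewrite -{1}(branch_digit b1 b2 ht) ltr_pM2r ?invr_gt0 // ltrD2l.
have : ~~ dig t by case: (dig t) bt.
move=> /negbTE /digit_lt /lt_le_trans; apply=> //.
by rewrite ler_pM2r ?invr_gt0 // lerDl branch_ge0.
Qed.

(** A word strictly above some digit sequence contains a digit 1, which alone contributes this
    much. *)
Lemma word_gt_branch_ge w t : word_gt w t -> (beta ^+ size w)^-1 <= branch beta w 0.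
Proof.
elim: w t => //= b w IH t h.
rewrite exprS invfM mulrC ler_pM2r ?invr_gt0 //.
move: h; case: eqP => [_ /IH h|_ ->].
  by apply: le_trans h _; rewrite lerDr ler0n.
apply: (@le_trans _ _ 1); last by rewrite lerDl branch_ge0.
by rewrite invf_le1 ?exprn_gt0 // exprn_ege1 // ltW.
Qed.

Lemma word_lt_itinerary n x t : 0 <= t < 1 -> 0 <= x < 1 -> t <= x ->
  ~~ word_lt (itin n x) t.
Proof.
elim: n t x => //= n IH t x ht hx tx; case: eqP => [e|].
  by apply: IH; rewrite ?beta_transform_bounds // beta_transform_le.
by have := digit_le tx; case: (dig x); case: (dig t).
Qed.

Lemma itinerary_norm_lt n x y : 0 <= x < 1 -> 0 <= y < 1 ->
  itin n x = itin n y -> `|x - y| < (beta ^+ n)^-1.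
Proof.
move=> hx hy e.
rewrite -(branch_itinerary b1 b2 n hx) -(branch_itinerary b1 b2 n hy) e.
rewrite norm_branchB // size_itinerary -[ltRHS]mul1r.
rewrite ltr_pM2r ?invr_gt0 ?exprn_gt0 //.
have /andP[] := iter_beta_transform_bounds beta n hx.
have /andP[] := iter_beta_transform_bounds beta n hy.
by move=> *; rewrite ltr_norml; apply/andP; split; lra.
Qed.

(** Otherwise [x] and [y] have the same digits at every length [n], so their distance is below
    [beta ^- n] for all [n]. *)
Lemma word_lt_exists x y : 0 <= x < 1 -> 0 <= y < 1 -> x < y ->
  exists n, word_lt (itin n x) y.
Proof.
move=> hx hy xy; apply: contrapT => /forallNP h.
have e n : itin n x = itin n y.
  have /negP/word_cmp[hn|->] := h n; last by rewrite size_itinerary.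
  have /andP[h0 _] := iter_beta_transform_bounds beta n hx.
  have := word_gt_branch hy h0 hn.
  by rewrite branch_itinerary // => /(lt_trans xy); rewrite ltxx.
have d0 : 0 < y - x by rewrite subr_gt0.
have [n _] := linear_lt_exp (y - x)^-1 0 b1.
have := itinerary_norm_lt hx hy (e n).
rewrite distrC gtr0_norm // -div1r ltr_pdivlMr ?exprn_gt0 // => h1.
rewrite mulrC ltr_pdivrMr // mulrC => h2; have := lt_trans h2 h1.
by rewrite ltrn1.
Qed.

Lemma word_gt_same_digits k w x t : itin k x = itin k t -> (size w <= k)%N ->
  word_gt w x = word_gt w t.
Proof.
elim: k w x t => [|k IH] [|b w] x t //= [-> e] s.
by case: ifP => // _; apply: IH.
Qed.

Lemma itinerary_lexi n x y : 0 <= x < 1 -> 0 <= y < 1 -> x <= y ->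
  ((itin n x : seqlexi bool) <= itin n y)%O.
Proof.
elim: n x y => [|n IH] x y hx hy xy /=; first by rewrite lexx.
rewrite lexi_cons; have /implyP := digit_le xy.
case e : (dig x); case e' : (dig y) => //= h.
- by apply: IH; rewrite ?beta_transform_bounds // beta_transform_le ?e.
- by have := h isT.
- by apply: IH; rewrite ?beta_transform_bounds // beta_transform_le ?e.
Qed.

End Compare.

(** * Admissible words in a multinacci base *)

Section Multinacci.
Context (R : realType) (beta : R) (b1 : 1 < beta) (b2 : beta < 2).
Context (m : nat).
Implicit Types (x y t : R) (w u v : seq bool) (j k n : nat).
Local Notation T := (beta_transform beta).
Local Notation itin := (itinerary beta).
Local Notation dig := (digit beta).
Local Notation branch := (branch beta).
Local Notation av := (bounded_runs m).
Local Notation st := (run_state m).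
Let b0 : 0 < beta. Proof. exact: lt_trans b1. Qed.

Definition ones_value j : R := branch (nseq j true) 0.
Local Notation c := ones_value.

(* The multinacci equation. *)
Context (hm : c m.+1 = 1).

Lemma ones_valueS j : c j.+1 = (1 + c j) / beta. Proof. by []. Qed.
Lemma ones_value0 : c 0 = 0. Proof. by []. Qed.
Lemma ones_value1 : c 1 = 1 / beta.
Proof. by rewrite ones_valueS addr0. Qed.

Lemma ones_value_ltS j : c j < c j.+1.
Proof.
elim: j => [|j IH]; first by rewrite ones_value1 divr_gt0.
by rewrite ones_valueS [ltRHS]ones_valueS ltr_pM2r ?invr_gt0 // ltrD2l.
Qed.

Lemma ones_value_le i j : (i <= j)%N -> c i <= c j.
Proof.
by move=> /subnKC <-; elim: (j - i)%N => [|k /le_trans IH];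
  rewrite ?addn0 // addnS; apply: IH; rewrite ltW // ones_value_ltS.
Qed.

Lemma ones_value_le1 j : (j <= m)%N -> c j.+1 <= 1.
Proof. by rewrite -hm => jm; apply: ones_value_le. Qed.

Lemma ones_value_m : c m = beta - 1.
Proof.
have := hm; rewrite ones_valueS => /(congr1 (fun z => z * beta)).
by rewrite mul1r mulfVK ?gt_eqF // => <-; rewrite addrAC subrr add0r.
Qed.

Lemma inv_beta_lt1 : 1 / beta < 1.
Proof. by rewrite div1r invf_lt1. Qed.

(** Induction along [w]: a digit 1 lowers the bound from c_(j+1) to c_j for the tail. After a digit
    0 the tail is below c_(m+1) = 1, so the whole is below 1 / beta = c_1. *)
Lemma branch_lt_ones j w y : (j <= m)%N -> av j w -> 0 <= y < 1 / beta ->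
  branch w y < c j.+1.
Proof.
move=> + + /andP[y0 y1]; elim: w j => [|[] w IH] [|j] //= jm a.
- by rewrite ones_value1.
- by apply: lt_le_trans y1 _; rewrite -ones_value1 ones_value_le.
- rewrite ones_valueS ltr_pM2r ?invr_gt0 // ltrD2l.
  by apply: IH => //; apply: ltnW.
all: apply: (@lt_le_trans _ _ (c 1)); last by rewrite ones_value_le.
all: rewrite ones_value1 ltr_pM2r ?invr_gt0 // add0r -hm; exact: IH.
Qed.

Lemma branch_le_ones j w y : (j <= m)%N -> av j w -> 0 <= y <= 1 / beta ->
  branch w y <= c j.+1.
Proof.
move=> + + /andP[y0 y1]; elim: w j => [|[] w IH] [|j] //= jm a.
- by rewrite ones_value1.
- by apply: le_trans y1 _; rewrite -ones_value1 ones_value_le.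
- rewrite ones_valueS ler_pM2r ?invr_gt0 // lerD2l.
  by apply: IH => //; apply: ltnW.
all: apply: (@le_trans _ _ (c 1)); last by rewrite ones_value_le.
all: rewrite ones_value1 ler_pM2r ?invr_gt0 // add0r -hm; exact: IH.
Qed.

(** Attaining the maximal value forces [w] to start with [j] ones, since an earlier 0 would keep the
    value at or below that of one digit 1. These ones alone contribute c_j. *)
Lemma branch_eq_ones j w y : (j <= m)%N -> av j w -> 0 <= y ->
  branch w (1 / beta) = c j.+1 -> c j <= branch w y.
Proof.
move=> + + y0; elim: w j => [|[] w IH] [|j] //= jm a.
- by rewrite -ones_value1 => /eqP; rewrite lt_eqF // (lt_le_trans (ones_value_ltS 1)) // ones_value_le.
- rewrite ones_valueS => /(mulIf _) e; rewrite ones_valueS.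
  rewrite ler_pM2r ?invr_gt0 // lerD2l; apply: IH => //; first exact: ltnW.
  by apply: addrI; apply: e; rewrite invr_neq0 // gt_eqF.
- by rewrite ones_value0 divr_ge0 ?addr_ge0 ?branch_ge0 // ltW.
- move=> /eqP; rewrite lt_eqF // (le_lt_trans _ (_ : c 1 < _)) //.
    rewrite ones_value1 add0r ler_pM2r ?invr_gt0 // -[leRHS]hm.
    by apply: branch_le_ones; rewrite // lexx andbT divr_ge0 // ltW.
  by rewrite (lt_le_trans (ones_value_ltS 1)) // ones_value_le.
Qed.

Lemma branch_bounds j w y : (j <= m)%N -> av j w -> 0 <= y < 1 / beta ->
  0 <= branch w y < 1.
Proof.
move=> jm a hy; have /andP[y0 _] := hy.
rewrite branch_ge0 //=; apply: lt_le_trans (branch_lt_ones jm a hy) _.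
exact: ones_value_le1.
Qed.

Lemma iter_branch j w y : (j <= m)%N -> av j w -> 0 <= y < 1 / beta ->
  forall i, (i <= size w)%N -> iter i T (branch w y) = branch (drop i w) y.
Proof.
move=> jm a hy; elim: w j jm a => [|b w IH] j jm a [|i] //= iw.
have aw : av m w by have := bounded_runs_drop 1 jm a; rewrite /= drop0.
rewrite -iterS iterSr (proj1 (beta_transform_branch b1 b2 _ _)).
- exact: (IH m).
- exact: branch_bounds (leqnn m) aw hy.
- by have /andP[] := branch_bounds jm a hy.
Qed.

(** As [y < 1 / beta], its first digit is 0, so putting an admissible [w] in front creates no
    forbidden run and the greedy digits are read off unchanged. *)
Lemma itinerary_branch j w y k : (j <= m)%N -> av j w -> 0 <= y < 1 / beta ->
  itin (size w + k) (branch w y) = w ++ itin k y.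
Proof.
move=> jm a hy; elim: w j jm a => [|b w IH] j jm a //=.
have aw : av m w by have := bounded_runs_drop 1 jm a; rewrite /= drop0.
have [] := beta_transform_branch b1 b2 (b := b) (branch_bounds (leqnn m) aw hy).
  by have /andP[] := branch_bounds jm a hy.
by move=> -> ->; rewrite (IH m).
Qed.

(** The invariant ties position to budget: with [j] ones still permitted the orbit is below c_(j+1).
    A digit 1 lowers the index by one, and a digit 0 resets the bound to c_(m+1) = 1. *)
Lemma itinerary_bounded_runs j n x : (j <= m)%N -> 0 <= x < 1 -> x < c j.+1 ->
  av j (itin n x) /\ iter n T x < c (st j (itin n x)).+1.
Proof.
elim: n j x => [|n IH] j x jm hx xj //.
have hT := beta_transform_bounds beta x.
rewrite iterSr /=; case d: (dig x); last first.
  by apply: IH => //; rewrite hm; case/andP: hT.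
move: xj; rewrite -{1}(branch_digit b1 b2 hx) d ones_valueS.
rewrite ltr_pM2r ?invr_gt0 // ltrD2l; case: j jm => [|j] jm xj.
  by case/andP: hT => /le_lt_trans /(_ xj); rewrite ltxx.
by apply: IH => //; apply: ltnW.
Qed.

Lemma itinerary_av n x : 0 <= x < 1 -> av m (itin n x).
Proof.
move=> hx; apply: (itinerary_bounded_runs n (leqnn m) hx _).1.
by rewrite hm; case/andP: hx.
Qed.

Lemma iter_lt_ones n x : 0 <= x < 1 -> iter n T x < c (st m (itin n x)).+1.
Proof.
move=> hx; apply: (itinerary_bounded_runs n (leqnn m) hx _).2.
by rewrite hm; case/andP: hx.
Qed.

Lemma run_state_cat j u v : st j (u ++ v) = st (st j u) v.
Proof. by elim: u j => //= [[]] u IH j. Qed.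

Lemma run_state_itineraryS n x :
  st m (itin n.+1 x) =
  if dig (iter n T x) then (st m (itin n x)).-1 else m.
Proof. by rewrite itineraryS -cats1 run_state_cat /=; case: (dig _). Qed.

(* Otherwise every digit from [k0] on would be the largest one allowed, and the
   gap between the orbit and its least upper bound would be multiplied by
   [beta] at each step. *)
Lemma raisable_digit x k0 : 0 <= x < 1 ->
  exists2 k, (k0 <= k)%N & ~~ dig (iter k T x) /\ (0 < st m (itin k x))%N.
Proof.
move=> hx; apply: contrapT => h.
have bad k : (k0 <= k)%N -> ~~ dig (iter k T x) -> st m (itin k x) = 0%N.
  move=> kk d; apply/eqP; rewrite -leqn0 leqNgt; apply/negP => s.
  by apply: h; exists k.
pose gap k := c (st m (itin k x)).+1 - iter k T x.
have gapS k : (k0 <= k)%N -> gap k.+1 = beta * gap k.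
  move=> kk; rewrite /gap run_state_itineraryS iterS.
  have hk := iter_beta_transform_bounds beta k hx.
  rewrite [T _](beta_transformE b1 b2 hk).
  case d: (dig (iter k T x)); last first.
    rewrite hm (bad k kk) ?d // ones_value1 subr0; field.
    by rewrite gt_eqF.
  have : (0 < st m (itin k x))%N.
    rewrite lt0n; apply/eqP => s0.
    have := iter_lt_ones k hx; rewrite s0 ones_value1.
    by rewrite ltNge digit_ge.
  case: (st m (itin k x)) => // s _ /=.
  by rewrite (ones_valueS s.+1); field; rewrite gt_eqF.
have gapX i : gap (k0 + i)%N = beta ^+ i * gap k0.
  elim: i => [|i IH]; first by rewrite addn0 mul1r.
  by rewrite addnS gapS ?leq_addr // IH exprS mulrA.
have g0 : 0 < gap k0 by rewrite subr_gt0 iter_lt_ones.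
have g1 k : gap k <= 1.
  rewrite lerBlDr; apply: (@le_trans _ _ 1).
    by apply: ones_value_le1; apply: run_state_le.
  by rewrite lerDl; case/andP: (iter_beta_transform_bounds beta k hx).
have [i _ hi] := linear_lt_exp (gap k0)^-1 0 b1.
have := g1 (k0 + i)%N; rewrite gapX leNgt => /negP; apply.
rewrite -ltr_pdivrMr // div1r; apply: le_lt_trans hi.
by rewrite ler_peMr ?invr_ge0 ?(ltW g0) // ler1n.
Qed.

Definition self_survivor t := 0 <= t < 1 /\ forall n, t <= iter n T t.

(* An orbit above [1 - 1 / beta] has [m] digits 1 after each digit 0, so none
   of its digits can be raised after the first 0. *)
Lemma orbit_lt x : 0 <= x < 1 -> exists n, iter n T x < 1 - 1 / beta.
Proof.
move=> hx; apply: contrapT => /forallNP hT.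
have cm : 1 - 1 / beta = c m / beta.
  by rewrite ones_value_m; field; rewrite gt_eqF.
have [k1 _ [d1 _]] := raisable_digit 0 hx.
have digit0 k : ~~ dig (iter k T x) -> c m <= iter k.+1 T x.
  move=> d; have /negP := hT k; rewrite -leNgt cm iterS.
  rewrite (beta_transformE b1 b2 (iter_beta_transform_bounds beta k hx)).
  by rewrite (negbTE d) subr0 ler_pdivrMr // mulrC.
(* After the first 0 the remaining budget also bounds the orbit from below. *)
have inv i : c (st m (itin (k1.+1 + i) x)) <= iter (k1.+1 + i) T x.
  elim: i => [|i IH].
    by rewrite addn0 run_state_itineraryS (negbTE d1) digit0.
  rewrite addnS run_state_itineraryS; set k := (k1.+1 + i)%N in IH *.
  have hk := iter_beta_transform_bounds beta k hx.
  case d: (dig _); last by apply: digit0; rewrite d.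
  rewrite iterS (beta_transformE b1 b2 hk) d.
  case: (st m (itin k x)) IH => [|s] /= IH.
    by rewrite ones_value0 subr_ge0 -ler_pdivrMl // mulrC; apply: digit_ge.
  by rewrite lerBrDl -ler_pdivrMl // mulrC -ones_valueS.
(* A raisable 0 has budget at least 1, so [inv] puts the orbit at or above c_1 = 1 / beta, where the
   digit is 1. *)
have [k kk [dk sk]] := raisable_digit k1.+1 hx.
have := inv (k - k1.+1)%N; rewrite subnKC // => h; move/negP: dk; apply.
by rewrite digit_ge_val // -ones_value1; apply: le_trans h; rewrite ones_value_le.
Qed.

Lemma self_survivor_lt t : self_survivor t -> t < 1 - 1 / beta.
Proof. by move=> [ht tT]; have [n] := orbit_lt ht; apply: le_lt_trans. Qed.

End Multinacci.

(** * The quasi-greedy expansion *)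

Section Streams.
Implicit Types (d : nat -> bool) (F : nat -> seq bool).

Definition cat_stream (p : nat) F : nat -> bool :=
  fun i => nth false (F (i %/ p)%N) (i %% p)%N.

Lemma mkseqD d n k : mkseq d (n + k) = mkseq d n ++ mkseq (seq_shift n d) k.
Proof.
rewrite /mkseq iotaD map_cat add0n; congr (_ ++ _).
by rewrite -[n in LHS]addn0 iotaDl -map_comp.
Qed.

Lemma seq_shiftD n k d : seq_shift n (seq_shift k d) = seq_shift (k + n) d.
Proof. by apply/funext => i; rewrite /seq_shift addnA. Qed.

Lemma seq_shift_cat_stream p F j : (0 < p)%N ->
  seq_shift (j * p) (cat_stream p F) = cat_stream p (fun i => F (j + i)%N).
Proof.
move=> p0; apply/funext => i.
by rewrite /seq_shift /cat_stream divnMDl // modnMDl.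
Qed.

Lemma mkseq_cat_stream p F : size (F 0%N) = p -> mkseq (cat_stream p F) p = F 0%N.
Proof.
move=> s; apply: (@eq_from_nth _ false); rewrite size_mkseq // => i ip.
by rewrite nth_mkseq // /cat_stream divn_small // modn_small.
Qed.

Lemma seq_lt_asym d d' : seq_lt d d' -> ~ seq_lt d' d.
Proof.
move=> [n e /andP[dn d'n]] [k e' /andP[d'k dk]].
have [nk|kn|nk] := ltngtP n k.
- by rewrite -(e' _ nk) d'n in dn.
- by rewrite (e _ kn) in dk; rewrite dk in d'k.
- by rewrite nk dk in dn.
Qed.

Lemma neq_first_diff (T : eqType) (d d' : nat -> T) : d <> d' ->
  exists2 n, (forall i, (i < n)%N -> d i = d' i) & d n != d' n.
Proof.
move=> dd'; have ex : exists n, d n != d' n.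
  apply: contrapT => /forallNP h; apply: dd'; apply/funext => n.
  by have /negP/negPn/eqP := h n.
case: (ex_minnP ex) => n dn hn; exists n => // i; rewrite ltnNge => /negP ni.
by apply/eqP/negPn/negP => di; apply: ni; apply: hn.
Qed.

Lemma bounded_runs_cat_stream (m : nat) F p n : (0 < p)%N ->
  (forall i, size (F i) = p /\ bounded_runs m 0 (F i)) ->
  bounded_runs m 0 (mkseq (cat_stream p F) n).
Proof.
move=> p0 hF.
have h k : forall G, (forall i, size (G i) = p /\ bounded_runs m 0 (G i)) ->
    bounded_runs m 0 (mkseq (cat_stream p G) (k * p)).
  elim: k => [//|k IH] G hG; rewrite mulSn mkseqD bounded_runs_cat0 //.
    by rewrite mkseq_cat_stream; case: (hG 0%N).
  have := seq_shift_cat_stream G 1 p0; rewrite mul1n => ->.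
  exact: IH.
have := h n F hF; rewrite -(subnKC (leq_pmulr n p0)) mkseqD => /(bounded_runs_take n).
by rewrite take_size_cat ?size_mkseq.
Qed.

End Streams.

(** * Value of an infinite digit sequence *)

Section Value.
Context (R : realType) (beta : R) (b1 : 1 < beta).
Implicit Types (d : nat -> bool).
Let b0 : 0 < beta. Proof. exact: lt_trans b1. Qed.
Local Notation branch := (branch beta).

Definition expansion_series d : R^nat :=
  [series (d i)%:R / beta ^+ i.+1]_i.

Definition expansion_value d : R := limn (expansion_series d).

Lemma expansion_seriesE d n : expansion_series d n = branch (mkseq d n) 0.
Proof.
rewrite /expansion_series; elim: n => [|n IH]; first by rewrite seriesEnat /= big_geq.
rewrite seriesSr IH mkseqS -cats1 branch_cat [in RHS](branch_affine b1).
by rewrite size_mkseq /= addr0 exprS; congr (_ + _); field; rewrite expf_neq0 ?gt_eqF.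
Qed.

Lemma is_cvg_expansion d : cvgn (expansion_series d).
Proof.
apply: nondecreasing_is_cvgn.
  apply: nondecreasing_series => i _ _.
  by rewrite divr_ge0 ?exprn_ge0 ?ler0n // ltW.
exists (1 / (beta - 1)) => _ [n _ <-]; rewrite expansion_seriesE.
have h : 0 <= 1 / (beta - 1) by rewrite divr_ge0 // subr_ge0 ltW.
elim: (mkseq d n) => [//|b w IH] /=.
rewrite ler_pdivrMr //.
have -> : 1 / (beta - 1) * beta = 1 + 1 / (beta - 1).
  by field; rewrite subr_eq0 gt_eqF.
by apply: lerD => //; case: b.
Qed.

Lemma expansion_value_ge0 d : 0 <= expansion_value d.
Proof.
apply: limr_ge; first exact: is_cvg_expansion.
by apply: nearW => n; rewrite expansion_seriesE branch_ge0.
Qed.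

Lemma expansion_value_le d M : (forall n, branch (mkseq d n) 0 <= M) ->
  expansion_value d <= M.
Proof.
move=> h; apply: limr_le; first exact: is_cvg_expansion.
by apply: nearW => n; rewrite expansion_seriesE.
Qed.

Lemma expansion_value1 d :
  expansion_value d = ((d 0%N)%:R + expansion_value (seq_shift 1 d)) / beta.
Proof.
apply: cvg_lim => //; rewrite -cvg_shiftS.
have -> : [sequence expansion_series d n.+1]_n =
   (fun n => ((d 0%N)%:R + expansion_series (seq_shift 1 d) n) / beta).
  apply/funext => n; rewrite /mk_sequence !expansion_seriesE -add1n mkseqD.
  by rewrite branch_cat.
apply: cvgMr_tmp; apply: cvgD; first exact: cvg_cst.
exact: is_cvg_expansion.
Qed.

Lemma expansion_valueD n d :
  expansion_value d = branch (mkseq d n) (expansion_value (seq_shift n d)).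
Proof.
elim: n d => [//|n IH] d; rewrite expansion_value1 (IH (seq_shift 1 d)).
by rewrite seq_shiftD -[n.+1]add1n mkseqD branch_cat.
Qed.

End Value.

Section QuasiGreedy.
Context (R : realType) (beta : R) (b1 : 1 < beta) (b2 : beta < 2).
Context (m : nat) (m0 : (0 < m)%N) (hm : ones_value beta m.+1 = 1).
Implicit Types (d : nat -> bool).
Let b0 : 0 < beta. Proof. exact: lt_trans b1. Qed.
Local Notation branch := (branch beta).
Local Notation val := (expansion_value beta).
Local Notation av := (bounded_runs m).

(** The sequence (1^m 0)^oo, which turns out to be the quasi-greedy expansion of 1. *)
Definition max_expansion : nat -> bool := fun i => (i %% m.+1 != m)%N.
Local Notation delta := max_expansion.

Lemma mkseq_delta_ones n : (n <= m)%N -> mkseq delta n = nseq n true.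
Proof.
move=> nm; apply: (@eq_from_nth _ false); rewrite size_mkseq ?size_nseq // => i i_n.
rewrite nth_mkseq // nth_nseq i_n /delta modn_small; first by rewrite ltn_eqF // (leq_trans i_n).
by rewrite ltnS ltnW // (leq_trans i_n).
Qed.

Lemma seq_shift_delta q : seq_shift (q * m.+1) delta = delta.
Proof. by apply/funext => i; rewrite /seq_shift /delta modnMDl. Qed.

(** Both 1 and this value are fixed by the branch of 1^m 0, a strict contraction. *)
Lemma val_delta : val delta = 1.
Proof.
have e : mkseq delta m.+1 = nseq m true ++ [:: false].
  by rewrite mkseqS mkseq_delta_ones // /delta modn_small // eqxx -cats1.
have h : branch (mkseq delta m.+1) 1 = 1.
  rewrite e branch_cat /= add0r -[RHS]hm /ones_value -(addn1 m) nseqD branch_cat /=.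
  by rewrite addr0.
have := expansion_valueD b1 m.+1 delta.
have := seq_shift_delta 1; rewrite mul1n => -> /(congr1 (fun z => z - 1)).
rewrite -[X in _ = _ - X -> _]h branchB // => /eqP.
rewrite -subr_eq0 -{1}(mulr1 (_ - 1)) -mulrBr mulf_eq0 subr_eq0 => /orP[/eqP//|].
rewrite subr_eq0 eq_sym invr_eq1 gt_eqF // exprn_egt1 //.
Qed.

(* A digit 0 of [delta] follows [m] digits 1. *)
Lemma delta_first_diff d n : (forall i, (i < n)%N -> d i = delta i) ->
  d n -> ~~ delta n ->
  exists2 q, n = (q * m.+1 + m)%N &
    mkseq d n.+1 = mkseq delta (q * m.+1) ++ nseq m.+1 true.
Proof.
move=> e dn /negPn/eqP nm.
have en : n = (n %/ m.+1 * m.+1 + m)%N by rewrite -{3}nm -divn_eq.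
exists (n %/ m.+1)%N => //.
have -> : nseq m.+1 true = nseq m true ++ [:: true] by rewrite -(addn1 m) nseqD.
rewrite mkseqS dn catA cats1; congr rcons.
have -> : mkseq d n = mkseq delta n.
  by apply/eq_in_map => i; rewrite mem_iota => /andP[_ /e].
by rewrite {1}en mkseqD seq_shift_delta (mkseq_delta_ones (leqnn m)).
Qed.

Lemma expansion_of_1_delta : infinite_expansion_of_1 beta delta.
Proof.
split.
  move=> n; exists (n * m.+1)%N; first by rewrite leq_pmulr.
  by rewrite /delta modnMl eq_sym -lt0n.
have : expansion_series beta delta @ \oo --> val delta.
  exact: is_cvg_expansion.
by rewrite val_delta.
Qed.

(** An expansion exceeding [delta] at the first difference starts with full periods of [delta]
    followed by [m + 1] ones. That prefix already has value 1, and a later digit 1 pushes the total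
    above 1. *)
Lemma expansion_of_1_le_delta d :
  infinite_expansion_of_1 beta d -> d = delta \/ seq_lt d delta.
Proof.
move=> [inf cv]; have v : val d = 1 by apply: cvg_lim cv.
apply: contrapT => /not_orP[/neq_first_diff[n e dn] nlt].
have [q nq eq] : exists2 q, n = (q * m.+1 + m)%N &
    mkseq d n.+1 = mkseq delta (q * m.+1) ++ nseq m.+1 true.
  apply: delta_first_diff => //; first apply/negPn/negP => dn0.
    by apply: nlt; exists n => //; rewrite dn0; case: (delta n) dn dn0; case: (d n).
  apply/negP => dn0; apply: nlt; exists n => //; rewrite dn0 andbT.
  by move: dn; rewrite dn0; case: (d n).
have := expansion_valueD b1 n.+1 d; rewrite v eq branch_cat.
have := expansion_valueD b1 (q * m.+1) delta; rewrite seq_shift_delta val_delta.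
move=> {1}-> /eqP; rewrite lt_eqF // ltr_branch //.
rewrite (branch_affine b1) -/(ones_value beta m.+1) hm ltrDl divr_gt0 ?exprn_gt0 //.
have [k nk dk] := inf n.+1.
rewrite (expansion_valueD b1 (k - n.+1)) branch_affine //.
rewrite ltr_wpDl ?branch_ge0 // divr_gt0 ?exprn_gt0 //.
rewrite seq_shiftD subnKC // expansion_value1 //.
by rewrite divr_gt0 // /seq_shift addn0 dk ltr_wpDr ?expansion_value_ge0.
Qed.

Lemma quasi_greedyE : quasi_greedy beta = delta.
Proof.
apply: get_unique.
  by split; [exact: expansion_of_1_delta|exact: expansion_of_1_le_delta].
move=> d [hd /(_ _ expansion_of_1_delta)[//|l]].
by have [//|/seq_lt_asym] := expansion_of_1_le_delta hd.
Qed.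

(** The value excludes [d = delta], and exceeding [delta] at the first difference would complete a
    run of [m + 1] ones. *)
Lemma seq_lt_delta d : (forall n, av m (mkseq d n)) -> val d < 1 ->
  seq_lt d delta.
Proof.
move=> a v; have : d <> delta by move=> e; rewrite e val_delta ltxx in v.
move=> /neq_first_diff[n e dn]; exists n => //.
case dd : (d n) dn => dn; last by case: (delta n) dn.
have [||q _ eq] := delta_first_diff e; first by rewrite dd.
  by case: (delta n) dn.
have := a n.+1; rewrite eq bounded_runs_cat => /andP[_].
by rewrite bounded_runs_ones ltnNge run_state_le.
Qed.

End QuasiGreedy.

(** * Lyndon intervals *)

Section Bifurcation.
Context (R : realType) (beta : R) (b1 : 1 < beta) (b2 : beta < 2).
Implicit Types (x y t : R).
Local Notation T := (beta_transform beta).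
Let b0 : 0 < beta. Proof. exact: lt_trans b1. Qed.

(** The digits are right-continuous functions of the point, so the first [n] of them are constant
    just to the right of [t]. *)
Lemma iter_right_affine n t : 0 <= t < 1 -> exists2 e, 0 < e &
  forall y, t <= y < t + e -> y < 1 ->
    iter n T y = iter n T t + beta ^+ n * (y - t).
Proof.
move=> ht; elim: n => [|n [e e0 IH]].
  by exists 1 => // y _ _; rewrite /= expr0 mul1r addrC subrK.
have hz := iter_beta_transform_bounds beta n ht.
set z := iter n T t in IH hz *.
(* The room left before the orbit of [y] meets the jump at [1 / beta]; beyond that jump the value 1
   is arbitrary. *)
pose f := if digit beta z then 1 else (1 / beta - z) / beta ^+ n.
have f0 : 0 < f.
  rewrite /f; case d: (digit beta z) => //.
  by rewrite divr_gt0 ?exprn_gt0 // subr_gt0 digit_lt.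
exists (Num.min e f); first by rewrite lt_min e0.
move=> y /andP[ty]; rewrite -ltrBlDl lt_min => /andP[ye yf] y1.
have hy := iter_beta_transform_bounds beta n (x := y).
have y01 : 0 <= y < 1 by rewrite y1 andbT (le_trans _ ty) //; case/andP: ht.
have {}IH : iter n T y = z + beta ^+ n * (y - t).
  by apply: IH => //; rewrite ty -ltrBlDl.
have d : digit beta (iter n T y) = digit beta z.
  have zy : z <= iter n T y.
    by rewrite IH lerDl mulr_ge0 ?exprn_ge0 ?subr_ge0 // ltW.
  have := digit_le b1 zy; move: yf; rewrite /f; case d: (digit beta z).
    by move=> _ /=.
  rewrite ltr_pdivlMr ?exprn_gt0 // mulrC => h _.
  apply/negbTE; rewrite digit_ge_val // -ltNge IH.
  by rewrite -ltrBrDl.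
rewrite !iterS (beta_transformE b1 b2 (hy y01)) (beta_transformE b1 b2 hz) d.
by rewrite IH exprS; ring.
Qed.

(** A self-surviving [t] belongs to its own survivor set and to none with a larger threshold. If
    instead an iterate takes [t] below itself, it also takes a right neighbourhood of [t] below [t];
    surviving orbits then avoid that neighbourhood, and the threshold can be raised without
    effect. *)
Lemma bif_setE : bif_set beta = [set t | self_survivor beta t].
Proof.
apply/seteqP; split => t /=; last first.
  move=> [ht h]; split=> // t' /andP[tt' t'1] e.
  have : survivor beta t t by split.
  by rewrite -e => -[_ /(_ 0%N)] /=; rewrite leNgt tt'.
move=> [ht h]; split=> // n; rewrite leNgt; apply/negP => Tt.
have [e e0 he] := iter_right_affine n ht.
have bn : 0 < beta ^+ n by rewrite exprn_gt0.
(* The three bounds keep the iterate affine, the new threshold below 1, and the image below [t]. *)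
pose f := Num.min e (Num.min (1 - t) ((t - iter n T t) / beta ^+ n)).
have f0 : 0 < f by rewrite !lt_min e0 divr_gt0 ?subr_gt0 //; case/andP: ht => _ ->.
have f1 : f <= 1 - t by rewrite !ge_min lexx orbT.
have /andP[t0 t1] := ht.
apply: (h (t + f / 2)); first by apply/andP; split; lra.
apply/seteqP; split => x [hx hT]; split=> // k.
  by apply: le_trans (hT k); lra.
rewrite leNgt; apply/negP => xk.
set y := iter k T x in xk.
have ty : t <= y by apply: hT.
have yf : y - t < f by lra.
have := hT (n + k)%N; rewrite iterD -/y he ?ty //=; last 2 first.
- by rewrite -ltrBlDl; apply: lt_le_trans yf _; rewrite ge_min lexx.
- by have := iter_beta_transform_bounds beta k hx; case/andP.
rewrite leNgt => /negP; apply.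
have : y - t < (t - iter n T t) / beta ^+ n.
  by apply: lt_le_trans yf _; rewrite !ge_min lexx !orbT.
by rewrite ltr_pdivlMr // mulrC ltrBrDl.
Qed.

End Bifurcation.

(** * Lyndon words as the digits up to the first return *)

Section Lyndon.
Context (R : realType) (beta : R) (b1 : 1 < beta) (b2 : beta < 2).
Context (m : nat) (m0 : (0 < m)%N) (hm : ones_value beta m.+1 = 1).
Implicit Types (x y t : R) (s w u v : seq bool).
Local Notation T := (beta_transform beta).
Local Notation itin := (itinerary beta).
Local Notation branch := (branch beta).
Local Notation av := (bounded_runs m).
Let b0 : 0 < beta. Proof. exact: lt_trans b1. Qed.

Lemma left_endE s : left_end beta s = branch s 0.
Proof.
rewrite /left_end; elim: s => [|b s IH]; first by rewrite big_ord0.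
rewrite big_ord_recl /= expr1 mulrDl -IH mulr_suml; congr (_ + _).
apply: eq_bigr => i _; rewrite /bump /= add1n [in LHS]exprS; field.
by rewrite expf_neq0 gt_eqF.
Qed.

(** The right end is the fixed point of the branch of [s]; to lie left of it means that undoing this
    expanding branch decreases [t]. *)
Lemma mem_Lyndon_interval s t : (0 < size s)%N ->
  `[left_end beta s, right_end beta s[%classic t =
  exists2 y, 0 <= y < t & t = branch s y.
Proof.
move=> s0; rewrite /= in_itv /=; apply/propext.
have bn : 1 < beta ^+ size s by rewrite exprn_egt1 // -lt0n.
have bn0 : 0 < beta ^+ size s by rewrite exprn_gt0.
have e : (t < right_end beta s) = ((t - branch s 0) * beta ^+ size s < t).
  rewrite /right_end left_endE mulrAC ltr_pdivlMr ?subr_gt0 //.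
  by rewrite mulrBr mulr1 ltrBlDr -ltrBlDl mulrBl [beta ^+ _ * branch s 0]mulrC.
rewrite e left_endE; split.
  move=> /andP[h1 h2]; exists ((t - branch s 0) * beta ^+ size s).
    by rewrite h2 andbT mulr_ge0 ?subr_ge0 // ltW.
  by rewrite branch_affine // mulfK ?gt_eqF // addrC subrK.
move=> [y /andP[y0 yt]]; rewrite (branch_affine b1) => {1 2}->.
by rewrite lerDl addrAC subrr add0r divfK ?gt_eqF // yt divr_ge0 // ltW.
Qed.

Lemma cat_nseq_run_at u v k :
  (k <= m)%N -> word_periodic (u ++ nseq m.+1 true ++ v) (size u + k)%N.
Proof.
move=> km; rewrite /word_periodic modn_small; last first.
  by rewrite !size_cat size_nseq ltn_add2l (leq_trans (_ : _ < m.+1)%N) // leq_addr.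
rewrite nth_cat ltnNge leq_addr addKn nth_cat size_nseq ltnS km.
by rewrite nth_nseq ltnS km.
Qed.

(** A run of [m + 1] ones, shifted to the front, would exceed (1^m 0)^oo. A leading 1 is impossible:
    a Lyndon word of length at least 2 ends in a letter larger than its first, and 1^oo is below no
    sequence. *)
Lemma Lyndon_bounded_runs s : beta_Lyndon beta s -> av 0 s.
Proof.
move=> [s0 lyn per].
have am : av m s.
  apply/negPn/negP => /bounded_runsPn ns.
  have [u [v es]] : exists u v, s = u ++ nseq m.+1 true ++ v.
    by case: ns => // -[v ->]; exists [::], v.
  have := per (size u); rewrite (quasi_greedyE b1 m0 hm) es => -[n e /andP[dn qn]].
  have [nm|mn] := leqP n m.
    by move: dn; rewrite /seq_shift cat_nseq_run_at.
  have := e _ mn; rewrite /seq_shift cat_nseq_run_at //.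
  by rewrite /max_expansion modn_small // eqxx.
case: s s0 lyn per am => [//|[] s] // _ lyn per _; case: s lyn per => [_|b s lyn _].
  by move=> /(_ 0%N)[n _]; rewrite /seq_shift /word_periodic /= modn1.
have := lyn (size s).+1 (ltnSn _).
rewrite [size (_ :: _)]/= subSnn /= (drop_nth false) // drop_oversize //.
by rewrite ltxi_cons /=; case: (nth _ _ _).
Qed.

(** An increasing contraction that does not raise [1 / beta] has no fixed point beyond it. *)
Lemma fixpoint_le s y : (0 < size s)%N -> av 0 s -> y = branch s y -> y <= 1 / beta.
Proof.
move=> s0 a e; rewrite leNgt; apply/negP => yb.
have h : branch s (1 / beta) <= 1 / beta.
  by rewrite -[leRHS]ones_value1; apply: (branch_le_ones b1 hm (leq0n m) a);
    rewrite lexx divr_ge0 // ltW.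
have := branchB b1 s y (1 / beta); rewrite -e => he.
have : (y - 1 / beta) / beta ^+ size s < y - 1 / beta.
  rewrite gtr_pMr ?subr_gt0 // invf_lt1 ?exprn_gt0 // exprn_egt1 //.
  by rewrite -lt0n.
by rewrite -he ltrD2l ltrN2 ltNge h.
Qed.

Lemma right_end_fix s : (0 < size s)%N ->
  right_end beta s = branch s (right_end beta s).
Proof.
move=> s0; have bn : 1 < beta ^+ size s by rewrite exprn_egt1 // -lt0n.
rewrite (branch_affine b1) /right_end left_endE; field.
by rewrite subr_eq0 !gt_eqF // exprn_gt0.
Qed.

Lemma right_end_le s : (0 < size s)%N -> av 0 s -> right_end beta s <= 1 / beta.
Proof. by move=> s0 a; apply: (fixpoint_le s0 a); exact: right_end_fix. Qed.

Lemma mem_interval_lt s y t : (0 < size s)%N -> av 0 s ->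
  0 <= y < t -> t = branch s y -> t < 1 / beta.
Proof.
move=> s0 a yt e.
have : `[left_end beta s, right_end beta s[%classic t.
  by rewrite mem_Lyndon_interval //; exists y.
rewrite /= in_itv /= => /andP[_ /lt_le_trans]; apply.
exact: right_end_le.
Qed.

Lemma mem_interval_return s y t : beta_Lyndon beta s ->
  0 <= y < t -> t = branch s y ->
  [/\ 0 <= t < 1 / beta, s = itin (size s) t, iter (size s) T t < t &
      forall i, (0 < i < size s)%N -> t < iter i T t].
Proof.
move=> ls yt e; have a := Lyndon_bounded_runs ls.
have [s0 lyn _] := ls; have tb := mem_interval_lt s0 a yt e.
have /andP[y0 yt'] := yt; have t0 : 0 <= t by rewrite (le_trans y0) // ltW.
have hy : 0 <= y < 1 / beta by rewrite y0 (lt_trans yt').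
have es : itin (size s) t = s.
  have := itinerary_branch b1 b2 hm 0 (leq0n m) a hy.
  by rewrite addn0 cats0 -e.
have it i : (i <= size s)%N -> iter i T t = branch (drop i s) y.
  by rewrite {1}e; apply: (iter_branch b1 b2 hm (leq0n m) a).
have t1 : 0 <= t < 1 by rewrite t0 (lt_trans tb) // inv_beta_lt1.
split; rewrite ?t0 //.
  by rewrite it // drop_size.
move=> i hi; have /andP[i0 isz] := hi; rewrite ltNge; apply/negP => Tt.
have := itinerary_lexi b1 b2 (size s - i) (iter_beta_transform_bounds beta i t1) t1 Tt.
rewrite -drop_itinerary es -(take_itinerary beta _ (leq_subr i (size s))) es leNgt.
by rewrite lyn.
Qed.

(** A common point [t] determines the word, as its digits up to its first return below itself. *)
Lemma Lyndon_intervals_trivIset : trivIset (Lyndon_intervals beta) id.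
Proof.
move=> I J [[s ls ->] _] [[s' ls' ->] _] [t [/= ht ht']].
have [s0 _ _] := ls; have [s0' _ _] := ls'.
move: ht; rewrite -[X in X -> _]/(`[_, _[%classic t) mem_Lyndon_interval // => -[y yt e].
move: ht'; rewrite -[X in X -> _]/(`[_, _[%classic t) mem_Lyndon_interval // => -[y' yt' e'].
have [_ es h1 h2] := mem_interval_return ls yt e.
have [_ es' h1' h2'] := mem_interval_return ls' yt' e'.
suff -> : s = s' by [].
have ss' : size s = size s'.
  case: (ltngtP (size s) (size s')) => // h.
  - by have := h2' (size s); rewrite s0 h => /(_ isT); rewrite ltNge ltW.
  - by have := h2 (size s'); rewrite s0' h => /(_ isT); rewrite ltNge ltW.
by rewrite es ss' -es'.
Qed.

Lemma mkseq_periodic s n : av 0 s -> (0 < size s)%N -> av 0 (mkseq (word_periodic s) n).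
Proof. by move=> a s0; apply: (@bounded_runs_cat_stream m (fun=> s)). Qed.

Lemma periodic_value s : (0 < size s)%N ->
  expansion_value beta (word_periodic s) =
  branch s (expansion_value beta (word_periodic s)).
Proof.
move=> s0; rewrite {1}(expansion_valueD b1 (size s)).
rewrite (mkseq_cat_stream (F := fun=> s)) //.
have := seq_shift_cat_stream (fun=> s) 1 s0; rewrite mul1n.
by rewrite -/(word_periodic s) => ->.
Qed.

Lemma seq_shift_periodic s n : (0 < size s)%N ->
  seq_shift n (word_periodic s) = seq_shift (n %% size s)%N (word_periodic s).
Proof.
move=> s0; apply/funext => i.
by rewrite /seq_shift /word_periodic modnDml.
Qed.

Lemma Lyndon_of_return t : 0 <= t -> t < 1 - 1 / beta -> ~ self_survivor beta t ->
  exists2 s, beta_Lyndon beta s & `[left_end beta s, right_end beta s[%classic t.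
Proof.
move=> t0 tm nt.
have tb : t < 1 / beta.
  apply: lt_trans tm _; rewrite ltrBlDr -mulrDl ltr_pdivlMr // mul1r.
  by have := b2; lra.
have ht : 0 <= t < 1 by rewrite t0 (lt_trans tb) // inv_beta_lt1.
have ex : exists n, iter n T t < t.
  apply: contrapT => /forallNP h; apply: nt; split => // n.
  by rewrite leNgt; apply/negP.
case: (ex_minnP ex) => p Tp pmin {ex nt}.
have p0 : (0 < p)%N by case: p Tp {pmin} => //=; rewrite ltxx.
have le i : (i < p)%N -> t <= iter i T t.
  by rewrite leNgt => ip; apply/negP => /pmin; rewrite leqNgt ip.
pose s := itin p t; have ss : size s = p by rewrite size_itinerary.
have d0 : digit beta t = false by apply/negbTE; rewrite digit_ge_val // -ltNge.
have es : s = false :: itin p.-1 (T t) by rewrite /s -{1}(prednK p0) /= d0.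
have aw : av m (itin p.-1 (T t)).
  by apply: itinerary_av => //; apply: beta_transform_bounds.
have a0 : av 0 s by rewrite es.
have Tp0 : 0 <= iter p T t by have /andP[] := iter_beta_transform_bounds beta p ht.
have et : t = branch s (iter p T t) by rewrite branch_itinerary.
have s0 : (0 < size s)%N by rewrite ss.
exists s; last first.
  by rewrite mem_Lyndon_interval //; exists (iter p T t) => //; rewrite Tp0.
(* Equality would, by [branch_eq_ones], give T t >= c_m = beta - 1, that is t >= 1 - 1 / beta. *)
have bs : branch s (1 / beta) < 1 / beta.
  rewrite lt_neqAle; apply/andP; split; last first.
    by rewrite -[leRHS]ones_value1; apply: (branch_le_ones b1 hm (leq0n m) a0);
      rewrite lexx divr_ge0 // ltW.
  apply/negP; rewrite {1}es /= add0r => /eqP e.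
  have {}e : branch (itin p.-1 (T t)) (1 / beta) = ones_value beta m.+1.
    by rewrite hm; apply: (mulIf _ e); rewrite invr_neq0 // gt_eqF.
  have := branch_eq_ones b1 hm (leqnn m) aw Tp0 e.
  have -> : iter p T t = iter p.-1 T (T t) by rewrite -iterSr prednK.
  rewrite branch_itinerary ?beta_transform_bounds //.
  rewrite (ones_value_m b1 hm) beta_transformE // d0 subr0 leNgt => /negP; apply.
  by move: tm; rewrite -(ltr_pM2l b0) mulrBr mulr1 mulrCA mulfV ?mulr1 // gt_eqF.
set v := expansion_value beta (word_periodic s).
have v0 : 0 <= v by apply: expansion_value_ge0.
have ev : v = branch s v by apply: periodic_value.
have vb : v < 1 / beta.
  rewrite ltNge; apply/negP => bv; have := fixpoint_le s0 a0 ev.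
  move=> vb; have evb : v = 1 / beta by apply/eqP; rewrite eq_le vb.
  by move: bs; rewrite -evb -ev ltxx.
split=> //.
- move=> i; rewrite ss => /andP[i0 ip].
  have pi : (p - i <= p)%N by apply: leq_subr.
  have le_i : ((take (p - i) s : seqlexi bool) <= drop i s)%O.
    rewrite take_itinerary // drop_itinerary.
    by apply: itinerary_lexi; rewrite ?iter_beta_transform_bounds // le.
  (* If the two words agree, cancelling their common branch in [t <= iter i T t] leaves
     [iter (p - i) T t <= iter p T t < t], against the minimality of [p]. *)
  rewrite lt_neqAle le_i andbT; apply/negP => /eqP.
  rewrite take_itinerary // drop_itinerary => e.
  have := le i ip.
  rewrite -[leLHS](branch_itinerary b1 b2 (p - i) ht).
  have hi := iter_beta_transform_bounds beta i ht.
  rewrite -[leRHS](branch_itinerary b1 b2 (p - i) hi).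
  rewrite e ler_branch // -iterD subnK ?(ltnW ip) // leNgt => /negP; apply.
  by apply: lt_le_trans Tp _; apply: le; rewrite -subn_gt0 subKn // ltnW.
(* Each shift of the periodic word has the value of a suffix of [s] applied to [v < 1 / beta], hence
   a value below 1. *)
- move=> n; rewrite (quasi_greedyE b1 m0 hm); apply: (seq_lt_delta b1 hm).
    move=> k; have := mkseq_periodic (n + k) a0 s0.
    rewrite mkseqD => /(bounded_runs_drop n (leq0n m)).
    by rewrite drop_size_cat ?size_mkseq.
  rewrite seq_shift_periodic //; set r := (n %% size s)%N.
  have rs : (r < size s)%N by rewrite ltn_mod.
  have : mkseq (seq_shift r (word_periodic s)) (size s - r) = drop r s.
    have := mkseqD (word_periodic s) r (size s - r).
    rewrite subnKC ?(ltnW rs) // (mkseq_cat_stream (F := fun=> s)) // => h.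
    by rewrite [in RHS]h drop_size_cat ?size_mkseq.
  rewrite (expansion_valueD b1 (size s - r)) seq_shiftD subnKC ?(ltnW rs) // => ->.
  have := seq_shift_cat_stream (fun=> s) 1 s0; rewrite mul1n.
  rewrite -/(word_periodic s) => ->.
  have ar := bounded_runs_drop r (leq0n m) a0.
  have hv : 0 <= v < 1 / beta by rewrite v0.
  by have /andP[] := branch_bounds b1 hm (leqnn m) ar hv.
Qed.

Lemma Lyndon_intervals_mem s : beta_Lyndon beta s ->
  Lyndon_intervals beta `[left_end beta s, right_end beta s[%classic.
Proof.
move=> ls; split; first by exists s.
move=> x /=; rewrite !in_itv /= => /andP[sx xs]; apply/andP; split.
  by apply: le_trans sx; rewrite left_endE branch_ge0.
have [s0 _ _] := ls.
apply: lt_le_trans xs _; apply: le_trans (right_end_le s0 (Lyndon_bounded_runs ls)) _.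
by rewrite ltW // inv_beta_lt1.
Qed.

Lemma self_survivorE : [set t | self_survivor beta t] =
  `[0, 1 - 1 / beta[ `\` \bigcup_(I in Lyndon_intervals beta) I.
Proof.
apply/seteqP; split => t /=.
  move=> st; have [ht tT] := st; split.
    by rewrite in_itv /= (self_survivor_lt b1 b2 hm) // andbT; case/andP: ht.
  move=> [I [[s ls ->] _]] /=; have [s0 _ _] := ls.
  rewrite -[X in X -> _]/(`[_, _[%classic t) mem_Lyndon_interval // => -[y yt e].
  have [_ _ + _] := mem_interval_return ls yt e.
  by rewrite ltNge tT.
rewrite in_itv /= => -[/andP[t0 tm] nI]; apply: contrapT => nt.
have [s ls ts] := Lyndon_of_return t0 tm nt; apply: nI.
exists `[left_end beta s, right_end beta s[%classic => //.
exact: Lyndon_intervals_mem.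
Qed.

End Lyndon.

(** * Hausdorff dimension *)

Section HausdorffDimension.
Context (R : realType).
Implicit Types (A B U : set R) (s e delta : R).

Lemma diam_le_real U e : U !=set0 -> (diam U <= e%:E)%E ->
  exists r, [/\ diam U = r%:E, 0 <= r <= e &
    forall x y, U x -> U y -> `|x - y| <= r].
Proof.
move=> [x Ux] Ue.
have h y z : U y -> U z -> (`|y - z|%:E <= diam U)%E.
  by move=> Uy Uz; apply: ereal_sup_ubound; exists (y, z).
have h0 := h _ _ Ux Ux; rewrite subrr normr0 in h0.
case eU : (diam U) Ue h0 h => [r| |] // re h0 h.
exists r; split=> //; first by rewrite -!lee_fin h0.
Qed.

Lemma diam_le_of_norm U e : 0 <= e -> (forall x y, U x -> U y -> `|x - y| <= e) ->
  (diam U <= e%:E)%E.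
Proof.
by move=> e0 h; apply: ge_ereal_sup => _ [[x y] [/= Ux Uy] <-]; rewrite lee_fin h.
Qed.

Lemma diam_set0_le e : (diam (set0 : set R) <= e%:E)%E.
Proof. by apply: ge_ereal_sup => z [[x y] [h _] _]; case: h. Qed.

Lemma diam_pow_ge0 s U : (0 <= diam_pow s U)%E.
Proof. by rewrite /diam_pow; case: ifP => // _; apply: poweR_ge0. Qed.

Lemma diam_pow_le s U e : 0 <= s -> (diam U <= e%:E)%E ->
  (diam_pow s U <= (e `^ s)%:E)%E.
Proof.
move=> s0 Ue; rewrite /diam_pow; case: eqVneq => [_|/set0P U0].
  by rewrite lee_fin powR_ge0.
have [r [-> /andP[r0 re] _]] := diam_le_real U0 Ue.
rewrite poweR_EFin lee_fin ge0_ler_powR ?nnegrE //.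
exact: le_trans re.
Qed.

Lemma hausdorff_content_ge0 s delta A : (0 <= hausdorff_content s delta A)%E.
Proof.
apply: le_ereal_inf_tmp => _ [U _ <-].
by apply: nneseries_ge0 => *; apply: diam_pow_ge0.
Qed.

Lemma hausdorff_measure_eq0 s A :
  (forall delta, 0 < delta -> (hausdorff_content s delta A <= 0)%E) ->
  hausdorff_measure s A = 0%E.
Proof.
move=> h; apply/eqP; rewrite eq_le; apply/andP; split.
  by apply: ge_ereal_sup => _ [d d0 <-]; apply: h.
apply: ereal_sup_ge; exists (hausdorff_content s 1 A); last exact: hausdorff_content_ge0.
by exists 1 => //=.
Qed.

Lemma hausdorff_measure_mono s A B : A `<=` B ->
  hausdorff_measure s B = 0%E -> hausdorff_measure s A = 0%E.
Proof.
move=> AB hB; apply: hausdorff_measure_eq0 => d d0.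
apply: (@le_trans _ _ (hausdorff_content s d B)).
  apply: ereal_inf_le_tmp => _ [U [BU Ud] <-]; exists U => //; split=> //.
  exact: subset_trans BU.
by rewrite -hB; apply: ereal_sup_ubound; exists d.
Qed.

Lemma hausdorff_dim_mono A B : A `<=` B -> (hausdorff_dim A <= hausdorff_dim B)%E.
Proof.
move=> AB; apply: ereal_inf_le_tmp => _ [s [s0 hs] <-]; exists s => //.
by split=> //; apply: hausdorff_measure_mono hs.
Qed.

Lemma hausdorff_dim_ge0 A : (0 <= hausdorff_dim A)%E.
Proof. by apply: le_ereal_inf_tmp => _ [s [s0 _] <-]; rewrite lee_fin. Qed.

(** A box-counting criterion: finite covers with one common bound on the diameters. *)
Lemma hausdorff_dim_le A sigma : 0 <= sigma ->
  (forall s delta e, sigma < s -> 0 < delta -> 0 < e ->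
    exists (k : nat) (U : nat -> set R) (r : R),
      [/\ A `<=` \bigcup_(i in [set i | (i < k)%N]) U i,
          forall i, (i < k)%N -> (diam (U i) <= r%:E)%E,
          r <= delta & k%:R * r `^ s <= e]) ->
  (hausdorff_dim A <= sigma%:E)%E.
Proof.
move=> s0 h; apply/lee_addgt0Pr => eps eps0; rewrite -EFinD.
have s1 : sigma < sigma + eps by rewrite ltrDl.
apply: ereal_inf_lbound; exists (sigma + eps) => //; split.
  by apply: addr_ge0 => //; apply: ltW.
apply: hausdorff_measure_eq0 => d d0; apply/lee_addgt0Pr => e e0; rewrite add0e.
have [k [U [r [AU Ur rd ke]]]] := h _ _ _ s1 d0 e0.
(* The cover is padded with empty sets, which cost 0. *)
pose V i := if (i < k)%N then U i else set0.
apply: ge_ereal_inf.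
exists (\sum_(0 <= i <oo) diam_pow (sigma + eps) (V i))%E.
  exists V => //; split.
    by move=> x /AU[i /= ik Ux]; exists i => //; rewrite /V ik.
  move=> i; rewrite /V; case: ifP => ik; last exact: diam_set0_le.
  by apply: le_trans (Ur _ ik) _; rewrite lee_fin.
apply: lime_le; first by apply: is_cvg_nneseries => *; apply: diam_pow_ge0.
apply: nearW => n; apply: (@le_trans _ _ (k%:R * r `^ (sigma + eps))%:E); last by rewrite lee_fin.
have h1 i : (diam_pow (sigma + eps) (V i) <= (if (i < k)%N then r `^ (sigma + eps) else 0)%:E)%E.
  rewrite /V; case: ifP => ik; last by rewrite /diam_pow eqxx.
  by apply: diam_pow_le; [rewrite addr_ge0 // ltW|exact: Ur].
apply: le_trans (lee_sum _ (fun i _ => h1 i)) _.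
rewrite sumEFin lee_fin.
have c0 : 0 <= r `^ (sigma + eps) by apply: powR_ge0.
apply: (@le_trans _ _ ((minn n k)%:R * r `^ (sigma + eps))); last first.
  by rewrite ler_wpM2r // ler_nat geq_minr.
elim: n => [|n IH]; first by rewrite big_geq // mulr_ge0.
rewrite big_nat_recr //=; apply: le_trans (lerD IH (lexx _)) _.
case: ltnP => nk; last by rewrite addr0 ler_wpM2r // ler_nat; lia.
by rewrite (minn_idPl (nk : (n.+1 <= k)%N)) -natr1 mulrDl mul1r.
Qed.

Lemma hausdorff_measure_gt0 s A (C : R) : 0 < C ->
  (forall U : nat -> set R, A `<=` \bigcup_i U i ->
    (forall i, (diam (U i) <= 1%:E)%E) ->
    (1 <= C%:E * \sum_(0 <= i <oo) diam_pow s (U i))%E) ->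
  hausdorff_measure s A <> 0%E.
Proof.
move=> C0 h e.
have : (C^-1%:E <= hausdorff_measure s A)%E.
  apply: ereal_sup_ge; exists (hausdorff_content s 1 A); first by exists 1 => /=.
  apply: le_ereal_inf_tmp => _ [U [AU U1] <-].
  by have := h U AU U1; rewrite -lee_pdivrMl // mule1.
by rewrite e lee_fin leNgt invr_gt0 C0.
Qed.

End HausdorffDimension.

(** * Radix expansions and a lower bound for the dimension of Cantor sets *)

Section RadixExpansion.
Context (R : realType) (N : nat) (N1 : (1 < N)%N).
Implicit Types (x y : R).
Local Notation S := (fun x : R => N%:R * x - (Num.Def.trunc (N%:R * x))%:R).

Definition radix_digit x i : nat := Num.Def.trunc (N%:R * iter i S x).

Let N0 : 0 < N%:R :> R. Proof. by rewrite ltr0n (ltn_trans _ N1). Qed.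

Lemma radix_step_bounds x : 0 <= x -> 0 <= S x < 1.
Proof.
move=> x0; have h : 0 <= N%:R * x by rewrite mulr_ge0 // ltW.
have /andP[h1 h2] := truncn_itv h.
by rewrite subr_ge0 h1 /= ltrBlDl natr1 .
Qed.

Lemma radix_iter_bounds i x : 0 <= x < 1 -> 0 <= iter i S x < 1.
Proof.
move=> hx; elim: i => [//|i IH]; rewrite iterS.
by apply: radix_step_bounds; case/andP: IH.
Qed.

Lemma radix_digit_lt x i : 0 <= x < 1 -> (radix_digit x i < N)%N.
Proof.
move=> hx; have /andP[h0 h1] := radix_iter_bounds i hx.
rewrite -(ltr_nat R); apply: (@le_lt_trans _ _ (N%:R * iter i S x)).
  by have /andP[] := truncn_itv (mulr_ge0 (ltW N0) h0).
by rewrite gtr_pMr.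
Qed.

Lemma radix_digit_dist x y j : 0 <= x < 1 -> 0 <= y < 1 ->
  (forall i, (i < j)%N -> radix_digit x i = radix_digit y i) ->
  `|x - y| <= (N%:R ^+ j)^-1.
Proof.
elim: j x y => [|j IH] x y hx hy h.
  by rewrite expr0 invr1; move: hx hy => /andP[? ?] /andP[? ?]; rewrite ler_norml; lra.
have /andP[x0 _] := hx; have /andP[y0 _] := hy.
have {}IH := IH _ _ (radix_step_bounds x0) (radix_step_bounds y0).
have e0 : Num.Def.trunc (N%:R * x) = Num.Def.trunc (N%:R * y) by apply: (h 0%N).
rewrite exprS invfM mulrC ler_pdivlMr // -[X in _ * X]gtr0_norm // -normrM.
have -> : (x - y) * N%:R = S x - S y by rewrite /= e0; ring.
by apply: IH => i ij; rewrite /radix_digit -!iterSr; apply: (h i.+1).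
Qed.

End RadixExpansion.

Section Cantor.
Context (R : realType).

(* The sets [g c] form a Cantor set built from [N] pieces of ratio [rho] at
   each stage; reading [c] in radix [N] is a Hoelder map of it onto [0, 1). *)
Lemma hausdorff_dim_ge (A : set R) (N : nat) (rho kappa sigma : R)
    (g : (nat -> nat) -> R) :
  (1 < N)%N -> 0 < rho <= 1 -> 0 < kappa -> 1 <= N%:R * rho `^ sigma ->
  (forall c, (forall i, (c i < N)%N) -> A (g c)) ->
  (forall c c' j, (forall i, (c i < N)%N) -> (forall i, (c' i < N)%N) ->
    (forall i, (i < j)%N -> c i = c' i) -> c j <> c' j ->
    kappa * rho ^+ j <= `|g c - g c'|) ->
  (sigma%:E <= hausdorff_dim A)%E.
Proof.
move=> N1 /andP[rho0 rho1] k0 hN gA sep.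
apply: le_ereal_inf_tmp => _ [s [s0 hs] <-]; rewrite lee_fin leNgt.
apply/negP => ssigma.
have N0 : 0 < N%:R :> R by rewrite ltr0n (ltn_trans _ N1).
have hNs : (N%:R)^-1 <= rho `^ s.
  rewrite -div1r ler_pdivrMr // mulrC; apply: le_trans hN _.
  rewrite ler_pM2l //; apply: ger_powR; last exact: ltW.
  by rewrite rho0.
(* The Hoelder constant: [C * (kappa * rho ^+ j)]^ s[equals](rho [^ s) ^+ j], which is at least
   [N ^- j]. *)
pose C := kappa `^ (- s).
have C0 : 0 < C by apply: powR_gt0.
(* The factor 2 is the length of an interval of radius 1. *)
have C20 : 0 < 2 * C by rewrite mulr_gt0.
move: hs; apply: (hausdorff_measure_gt0 C20) => U AU U1.
pose gx (x : R) := g (radix_digit N x).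
pose d i := fine (diam_pow s (U i)).
have dE i : diam_pow s (U i) = (d i)%:E.
  rewrite /d fineK // ge0_fin_numE ?diam_pow_ge0 //.
  by apply: le_lt_trans (diam_pow_le s0 (U1 i)) _; rewrite ltry.
have d0 i : 0 <= d i by rewrite -lee_fin -dE diam_pow_ge0.
have close i (x y : R) : 0 <= x < 1 -> 0 <= y < 1 -> U i (gx x) -> U i (gx y) ->
    `|x - y| <= C * d i.
  move=> hx hy Ux Uy.
  have [r [dr /andP[r0 _] hr]] := diam_le_real (ex_intro _ _ Ux) (U1 i).
  have dri : d i = r `^ s.
    apply: EFin_inj; rewrite -dE /diam_pow dr poweR_EFin.
    case: eqVneq => // e; by rewrite e in Ux.
  have [->|xy] := eqVneq x y; first by rewrite subrr normr0 mulr_ge0 // ltW.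
  have exj : exists j, radix_digit N x j != radix_digit N y j.
    apply: contrapT => /forallNP h.
    have xy0 : 0 < `|x - y| by rewrite normr_gt0 subr_eq0.
    have N1' : 1 < N%:R :> R by rewrite ltr1n.
    have [j _ hj] := linear_lt_exp `|x - y|^-1 0 N1'.
    have : `|x - y| <= (N%:R ^+ j)^-1.
      by apply: radix_digit_dist => // k _; have /negP/negPn/eqP := h k.
    rewrite -div1r ler_pdivlMr ?exprn_gt0 // leNgt => /negP; apply.
    move: hj; rewrite mulrC ltr_pdivrMr // mulrC; apply: le_lt_trans.
    by rewrite ler1n.
  case: (ex_minnP exj) => j dj jmin.
  have same k : (k < j)%N -> radix_digit N x k = radix_digit N y k.
    by rewrite ltnNge => kj; apply/eqP/negPn/negP => /jmin; apply/negP.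
  have h1 := radix_digit_dist N1 hx hy same.
  have h2 : kappa * rho ^+ j <= r.
    apply: le_trans (hr _ _ Ux Uy); apply: sep => //.
    - by move=> k; apply: radix_digit_lt.
    - by move=> k; apply: radix_digit_lt.
    - exact/eqP.
  apply: le_trans h1 _; rewrite dri /C.
  apply: (@le_trans _ _ ((rho `^ s) ^+ j)).
    by rewrite -exprVn lerXn2r // nnegrE ?invr_ge0 ?powR_ge0 // ltW.
  have -> : (rho `^ s) ^+ j = kappa `^ (- s) * (kappa * rho ^+ j) `^ s.
    rewrite powRM ?exprn_ge0 ?(ltW k0) ?(ltW rho0) // mulrA -powRD; last first.
      by apply/implyP => _; rewrite gt_eqF.
    rewrite addNr powRr0 mul1r -(powR_mulrn j (powR_ge0 rho s)).
    by rewrite -(powR_mulrn j (ltW rho0)) -!powRrM mulrC.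
  rewrite ler_pM2l //; apply: ge0_ler_powR; rewrite ?nnegrE //.
  by rewrite mulr_ge0 ?exprn_ge0 ?(ltW k0) ?(ltW rho0).
(* A set that contains no [gx x] gets the arbitrary centre 0. *)
have exc i : exists z, forall x : R, 0 <= x < 1 -> U i (gx x) -> `|x - z| <= C * d i.
  have [[x0 [hx0 U0]]|nex] := pselect (exists x, 0 <= x < 1 /\ U i (gx x)).
    by exists x0 => x hx Ux; apply: close.
  by exists 0 => x hx Ux; exfalso; apply: nex; exists x.
have [z hz] := choice exc.
pose F i := `[z i - C * d i, z i + C * d i]%classic.
have cover : `[0, 1[%classic `<=` \bigcup_i F i.
  move=> x /=; rewrite in_itv /= => hx.
  have [i _ Ui] := AU (gx x) (gA _ (fun i => radix_digit_lt N1 i hx)).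
  exists i => //; rewrite /F /= in_itv /=.
  have := hz i x hx Ui; rewrite ler_norml => /andP[? ?].
  by apply/andP; split; lra.
(* The intervals [F i] cover [0, 1), so their total length is at least 1. *)
pose I01 : set R := `[0, 1[%classic.
have : (lebesgue_measure I01 <= \sum_(0 <= i <oo) lebesgue_measure (F i : set R))%E.
  by apply: measure_sigma_subadditive => // *; exact: measurable_itv.
rewrite lebesgue_measure_itv /= lte_fin ltr01 -EFinB subr0 => /le_trans; apply.
rewrite -nneseriesZl; last by move=> i _; apply: diam_pow_ge0.
apply: lee_nneseries => [i _ _|i _]; first exact: measure_ge0.
rewrite dE lebesgue_measure_itv /= lte_fin; case: ifP => _.
  by rewrite -EFinB -EFinM lee_fin; lra.
by rewrite -EFinM lee_fin mulr_ge0 // ltW.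
Qed.

End Cantor.

(** * Counting words *)

Definition words (n : nat) : seq (seq bool) := [seq val u | u : n.-tuple bool].

Lemma words_uniq n : uniq (words n).
Proof. by rewrite map_inj_uniq ?enum_uniq //; apply: val_inj. Qed.

Lemma mem_words n w : (w \in words n) = (size w == n).
Proof.
apply/mapP/eqP => [[u _ ->]|sw]; first by rewrite size_tuple.
by exists (Tuple (introT eqP sw)); rewrite ?mem_enum.
Qed.

Lemma powR_gt1 (R : realType) (a x : R) : 1 < a -> 0 < x -> 1 < a `^ x.
Proof.
move=> a1 x0; have := @gt0_ltr_powR _ _ x0 1 a.
rewrite powR1 !nnegrE; apply=> //; exact: le_trans (ltW a1).
Qed.

Lemma powR_exprVn (R : realType) (a : R) (n : nat) (x : R) : 0 <= a ->
  (a ^- n) `^ x = (a `^ x ^+ n)^-1.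
Proof.
move=> a0; rewrite -(powR_invn _ a0) -powRrM -(powR_mulrn _ (powR_ge0 _ _)).
by rewrite -powRrM -powRN mulNr mulrC.
Qed.

Section Counting.
Context (R : realType) (beta : R) (b1 : 1 < beta) (b2 : beta < 2).
Context (m : nat) (hm : ones_value beta m.+1 = 1).
Implicit Types (x y t : R) (s w u v : seq bool) (n k i j : nat).
Local Notation T := (beta_transform beta).
Local Notation itin := (itinerary beta).
Local Notation branch := (branch beta).
Local Notation av := (bounded_runs m).
Local Notation gt := (word_gt beta).
Local Notation lt := (word_lt beta).
Let b0 : 0 < beta. Proof. exact: lt_trans b1. Qed.

(* All nonempty suffixes of [w] lie strictly above the digits of [t]: unlike
   for [allowed], this is stable under concatenation. *)
Definition above t w : bool :=
  av 0 w && [forall i : 'I_(size w), gt (drop i w) t].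

Definition allowed t w : bool :=
  av m w && [forall i : 'I_(size w), ~~ lt (drop i w) t].

Lemma aboveP t w :
  reflect (av 0 w /\ forall i, (i < size w)%N -> gt (drop i w) t) (above t w).
Proof.
apply: (iffP andP) => -[a h]; split=> //.
  by move=> i iw; have /forallP/(_ (Ordinal iw)) := h.
by apply/forallP => i; apply: h.
Qed.

Lemma allowedP t w :
  reflect (av m w /\ forall i, ~~ lt (drop i w) t) (allowed t w).
Proof.
apply: (iffP andP) => -[a h]; split=> //; last by apply/forallP.
move=> i; have [iw|wi] := ltnP i (size w); last by rewrite drop_oversize.
by have /forallP/(_ (Ordinal iw)) := h.
Qed.

Lemma above_cat t u v : above t u -> above t v -> above t (u ++ v).
Proof.
move=> /aboveP[au hu] /aboveP[a_v hv]; apply/aboveP; split.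
  exact: bounded_runs_cat0.
move=> i; rewrite size_cat drop_cat; case: (ltnP i (size u)) => iu h.
  by apply: word_gt_cat; apply: hu.
by apply: hv; rewrite ltn_subLR.
Qed.

Lemma above_le t t' w : 0 <= t < 1 -> 0 <= t' < 1 -> t <= t' ->
  above t' w -> above t w.
Proof.
move=> ht ht' tt' /aboveP[a h]; apply/aboveP; split=> // i iw.
by apply: (word_gt_le b1 b2 ht ht' tt'); apply: h.
Qed.

Lemma allowed_catl t u v : allowed t (u ++ v) -> allowed t u.
Proof.
move=> /allowedP[a h]; apply/allowedP; split.
  by move: a; rewrite bounded_runs_cat => /andP[].
move=> i; have := h i; rewrite drop_cat; case: ltnP => iu.
  by apply: contra; apply: word_lt_cat.
by rewrite [drop i u]drop_oversize.
Qed.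

Lemma allowed_drop t u n : allowed t u -> allowed t (drop n u).
Proof.
move=> /allowedP[a h]; apply/allowedP; split; first exact: bounded_runs_drop a.
by move=> i; rewrite drop_drop.
Qed.

Lemma allowed_itinerary t x n : 0 <= t < 1 -> survivor beta t x ->
  allowed t (itin n x).
Proof.
move=> ht [hx h]; apply/allowedP; split; first exact: itinerary_av.
move=> i; rewrite drop_itinerary.
by apply: word_lt_itinerary => //; apply: iter_beta_transform_bounds.
Qed.

(* The suffix [drop k u] is the longest one that agrees with [t]. *)
Lemma allowed_split t u : self_survivor beta t -> allowed t u ->
  exists2 k, (k <= size u)%N & u = take k u ++ itin (size u - k) t /\
    forall i, (i < k)%N -> gt (drop i (take k u)) t.
Proof.
move=> [ht tT] /allowedP[_ hu].
have ex : exists k, (k <= size u)%N && (drop k u == itin (size u - k) t).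
  by exists (size u); rewrite leqnn drop_size subnn /=.
case: (ex_minnP ex) => k /andP[ku /eqP dk] kmin; exists k => //.
split; first by rewrite -dk cat_take_drop.
move=> i ik; have iu : (i <= size u)%N by rewrite (leq_trans (ltnW ik)).
have gi : gt (drop i u) t.
  have [//|] := word_cmp (hu i); rewrite size_drop => e.
  by have := kmin i; rewrite iu e eqxx leqNgt ik => /(_ isT).
have sk : size (take k u) = k by rewrite size_takel.
have eu : drop i u = drop i (take k u) ++ itin (size u - k) t.
  rewrite -{1}(cat_take_drop k u) drop_cat sk ik; by rewrite dk.
have nl : ~~ lt (drop i (take k u)) t.
  by apply: contra (hu i); rewrite eu; apply: word_lt_cat.
have [//|e] := word_cmp nl.
(* Were this suffix of [take k u] a prefix of [t], a prefix of [t] would lie above an iterate of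
   [t], hence above [t] itself. *)
move: gi; rewrite eu e word_gt_itinerary_cat => gi.
have := word_gt_le b1 b2 ht (iter_beta_transform_bounds beta _ ht) (tT _) gi.
by rewrite word_gt_itinerary.
Qed.

Definition above_words t n : seq (seq bool) := [seq w <- words n | above t w].

Definition allowed_words t n : seq (seq bool) := [seq w <- words n | allowed t w].

Lemma mem_above_words t n w :
  (w \in above_words t n) = above t w && (size w == n).
Proof. by rewrite mem_filter mem_words. Qed.

Lemma mem_allowed_words t n w :
  (w \in allowed_words t n) = allowed t w && (size w == n).
Proof. by rewrite mem_filter mem_words. Qed.

Lemma above_words_uniq t n : uniq (above_words t n).
Proof. by rewrite filter_uniq // words_uniq. Qed.

Lemma allowed_words_uniq t n : uniq (allowed_words t n).
Proof. by rewrite filter_uniq // words_uniq. Qed.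

Fixpoint above_words_upto t n : seq (seq bool) :=
  (if n is n'.+1 then above_words_upto t n' else [::]) ++ above_words t n.

Lemma mem_above_words_upto t n w :
  (w \in above_words_upto t n) = above t w && (size w <= n)%N.
Proof.
elim: n => [|n IH] /=; first by rewrite mem_above_words leqn0.
rewrite mem_cat IH mem_above_words -andb_orr; congr (_ && _).
by rewrite [RHS]leq_eqVlt ltnS orbC.
Qed.

Lemma above_words_upto_uniq t n : uniq (above_words_upto t n).
Proof.
elim: n => [|n IH] /=; first exact: above_words_uniq.
rewrite cat_uniq IH above_words_uniq andbT /=; apply/hasPn => w.
rewrite mem_above_words mem_above_words_upto => /andP[_ /eqP ->].
by rewrite ltnn andbF.
Qed.

Lemma sum_above_words_upto t n (f : nat -> R) :
  \sum_(w <- above_words_upto t n) f (size w) =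
  \sum_(k < n.+1) (size (above_words t k))%:R * f k.
Proof.
have h k : \sum_(w <- above_words t k) f (size w) =
    (size (above_words t k))%:R * f k.
  rewrite (eq_big_seq (fun=> f k)); last first.
    by move=> w; rewrite mem_above_words => /andP[_ /eqP ->].
  by rewrite big_const_seq count_predT iter_addr_0 mulr_natl.
elim: n => [|n IH] /=; first by rewrite h big_ord_recl big_ord0 addr0.
by rewrite big_cat IH h [RHS]big_ord_recr.
Qed.

Lemma size_above_words_upto t n :
  (size (above_words_upto t n))%:R =
  \sum_(k < n.+1) (size (above_words t k))%:R :> R.
Proof.
have := sum_above_words_upto t n (fun=> 1).
rewrite big_const_seq count_predT iter_addr_0 => ->.
by apply: eq_bigr => i _; rewrite mulr1.
Qed.

(** The number of leading ones, at most [m], and the middle word determine the whole word: a prefix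
    of [t] fills the rest. *)
Lemma size_allowed_words_le t n : self_survivor beta t ->
  (size (allowed_words t n) <= m.+1 * size (above_words_upto t n))%N.
Proof.
move=> st; rewrite -[X in (X * _)%N](size_iota 0 m.+1).
pose f j w := nseq j true ++ w ++ itin (n - j - size w) t.
rewrite -(size_allpairs f); apply: uniq_leq_size; first exact: allowed_words_uniq.
move=> u; rewrite mem_allowed_words => /andP[au /eqP su].
have [k ku [eu gu]] := allowed_split st au.
have /allowedP[a _] := allowed_catl (eq_ind u (allowed t) au _ eu).
have [j jm [ex ax]] := bounded_runs_split a.
set w := drop j (take k u) in ex ax.
have sw : (size w + j)%N = k.
  have := congr1 size ex; rewrite size_takel // size_cat size_nseq => ->.
  by rewrite addnC.
apply/allpairsP; exists (j, w); split; rewrite ?[_.1]/= ?[_.2]/=.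
- by rewrite mem_iota add0n.
- rewrite mem_above_words_upto -su (leq_trans _ ku) -?sw ?leq_addr // andbT.
  apply/aboveP; split=> // i iw; rewrite /w drop_drop; apply: gu.
  by rewrite -sw ltn_add2r.
- rewrite /f -subnDA addnC sw -su catA -ex; exact: eu.
Qed.

Lemma size_allowed_wordsD t a b :
  (size (allowed_words t (a + b)) <=
   size (allowed_words t a) * size (allowed_words t b))%N.
Proof.
rewrite -(size_allpairs cat); apply: uniq_leq_size; first exact: allowed_words_uniq.
move=> u; rewrite mem_allowed_words => /andP[au /eqP su].
apply/allpairsP; exists (take a u, drop a u); rewrite /= cat_take_drop.
rewrite !mem_allowed_words allowed_drop // size_drop su addKn eqxx.
rewrite (@allowed_catl _ _ (drop a u)) ?cat_take_drop // size_takel ?eqxx //.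
by rewrite su leq_addr.
Qed.

Lemma size_allowed_words0 t : (size (allowed_words t 0) <= 1)%N.
Proof.
by rewrite size_filter (leq_trans (count_size _ _)) // size_map -cardE card_tuple.
Qed.

Lemma size_allowed_wordsM t n j :
  (size (allowed_words t (j * n)) <= size (allowed_words t n) ^ j)%N.
Proof.
elim: j => [|j IH]; first exact: size_allowed_words0.
by rewrite mulSn expnS (leq_trans (size_allowed_wordsD _ _ _)) // leq_mul2l IH orbT.
Qed.

(** By submultiplicativity a count at one length [n] bounds the counts at all multiples of [n]; the
    cylinders of these lengths form the covers. *)
Lemma survivor_dim_le t n sigma : 0 <= t < 1 -> (0 < n)%N -> 0 <= sigma ->
  (size (allowed_words t n))%:R <= (beta `^ sigma) ^+ n ->
  (hausdorff_dim (survivor beta t) <= sigma%:E)%E.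
Proof.
move=> ht n0 s0 hL; apply: hausdorff_dim_le => // s delta e ss d0 e0.
pose q := beta `^ (s - sigma).
have q1 : 1 < q by rewrite powR_gt1 // subr_gt0.
have bs k : beta `^ s ^+ k = q ^+ k * beta `^ sigma ^+ k.
  rewrite -exprMn -powRD ?subrK //; by apply/implyP => _; rewrite gt_eqF.
pose C := Num.max delta^-1 e^-1.
have [j0 _ hj0] := linear_lt_exp C 0 b1.
have [j1 j01 hj1] := linear_lt_exp C j0 q1.
pose j := (j1 * n)%N.
have jj1 : (j1 <= j)%N by rewrite leq_pmulr.
pose L := allowed_words t j.
exists (size L), (fun i => [set x | 0 <= x < 1 /\ itin j x = nth [::] L i]), (beta ^- j).
split.
- move=> x sx; have /allowed_itinerary := sx => /(_ j ht) ax.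
  have xL : itin j x \in L by rewrite mem_allowed_words ax size_itinerary eqxx.
  exists (index (itin j x) L); first by rewrite /= index_mem.
  by rewrite /= nth_index //; case: sx.
- move=> i _; apply: diam_le_of_norm; first by rewrite invr_ge0 exprn_ge0 // ltW.
  move=> x y [hx ex] [hy ey]; apply: ltW.
  by apply: (itinerary_norm_lt b1 b2 hx hy); rewrite ex ey.
- rewrite -[leRHS]invrK lef_pV2 ?posrE ?invr_gt0 ?exprn_gt0 //.
  apply: (@le_trans _ _ (beta ^+ j0)); last first.
    by rewrite ler_eXn2l // (leq_trans j01).
  apply: le_trans (ltW hj0); apply: (@le_trans _ _ C).
    by rewrite /C le_max lexx.
  by rewrite ler_peMr ?ler1n // /C le_max invr_ge0 (ltW d0).
have hk : (size L)%:R <= beta `^ sigma ^+ j.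
  apply: (@le_trans _ _ ((size (allowed_words t n) ^ j1)%:R)).
    by rewrite ler_nat size_allowed_wordsM.
  rewrite natrX /j mulnC exprM lerXn2r // ?nnegrE ?exprn_ge0 ?powR_ge0 //.
rewrite (powR_exprVn j s (ltW b0)).
rewrite ler_pdivrMr ?exprn_gt0 ?powR_gt0 //.
apply: le_trans hk _; rewrite bs mulrA ler_peMl ?exprn_ge0 ?powR_ge0 //.
rewrite -ler_pdivrMl // mulr1.
apply: (@le_trans _ _ (q ^+ j1)); last by rewrite ler_eXn2l.
apply: le_trans (ltW hj1); apply: (@le_trans _ _ C).
  by rewrite /C le_max lexx orbT.
by rewrite ler_peMr ?ler1n // /C le_max invr_ge0 (ltW d0).
Qed.

End Counting.

(** * The bifurcation set to the right of a point *)

Section Lower.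
Context (R : realType) (beta : R) (b1 : 1 < beta) (b2 : beta < 2).
Context (m : nat) (hm : ones_value beta m.+1 = 1).
Implicit Types (x y t : R) (s w u v : seq bool) (n k i j : nat).
Local Notation T := (beta_transform beta).
Local Notation itin := (itinerary beta).
Local Notation branch := (branch beta).
Local Notation av := (bounded_runs m).
Local Notation gt := (word_gt beta).
Local Notation lt := (word_lt beta).
Local Notation above := (above beta m).
Local Notation above_words := (above_words beta m).
Local Notation allowed_words := (allowed_words beta m).
Let b0 : 0 < beta. Proof. exact: lt_trans b1. Qed.

(** At the first difference, the point with digit 0 is at most 1 / beta because its tail is at most
    c_(m+1) = 1, and the point with digit 1 exceeds 1 / beta by at least its tail divided by
    [beta]. *)
Lemma branch_sep (kappa : R) u v y y' : 0 <= kappa ->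
  kappa <= y <= 1 / beta -> kappa <= y' <= 1 / beta ->
  size u = size v -> av m u -> av m v -> u <> v ->
  kappa / beta ^+ size u <= `|branch u y - branch v y'|.
Proof.
move=> k0.
have tailP (b : bool) w : av m (b :: w) -> av m w.
  by move=> /(bounded_runs_drop 1 (leqnn m)); rewrite /= drop0.
have main z z' w w' : kappa <= z <= 1 / beta -> kappa <= z' ->
    size w = size w' -> av m w ->
    kappa / beta ^+ (size w).+1 <=
      `|branch (true :: w') z' - branch (false :: w) z|.
  move=> /andP[kz zb] kz' sw aw.
  apply: le_trans (ler_norm _); rewrite lerBrDl /=.
  have h1 : branch w z <= 1.
    by rewrite -hm; apply: (branch_le_ones b1 hm (leqnn m) aw); rewrite (le_trans k0 kz).
  have h2 : kappa / beta ^+ size w <= branch w' z'.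
    rewrite (branch_affine b1) sw; apply: (@le_trans _ _ (z' / beta ^+ size w')).
      by rewrite ler_pM2r // invr_gt0 exprn_gt0.
    by rewrite lerDr branch_ge0.
  rewrite exprS invfM mulrCA -[_^-1 * _]mulrC -mulrDl ler_pM2r ?invr_gt0 //.
  by apply: lerD => //; rewrite add0r.
move=> /[dup] /andP[ky _] hy /[dup] /andP[ky' _] hy'.
elim: u v => [|b u IH] [|b' v] //= [suv] au a_v uv.
case: (eqVneq b b') uv => [eb uv|bb' _]; first rewrite eb.
  rewrite -mulrBl opprD addrACA subrr add0r normrM.
  rewrite [`|beta^-1|]gtr0_norm ?invr_gt0 // exprS invfM mulrCA mulrC.
  rewrite ler_pM2r ?invr_gt0 //; apply: IH => //.
  - exact: (tailP b _ au).
  - exact: (tailP b' _ a_v).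
  - by move=> e; apply: uv; rewrite e eb.
case: b b' bb' au a_v => [] [] // _ au a_v; last first.
  by rewrite distrC; apply: main.
by rewrite suv; apply: main.
Qed.

Section Stream.
Context (t : R) (n : nat) (n0 : (0 < n)%N) (F : seq (seq bool)).
Context (Fabove : forall w, w \in F ->
  [/\ above t w, size w = n & branch w (1 / beta) < 1 / beta]).
Implicit Types c : nat -> nat.

Definition block_stream c := cat_stream n (fun i => nth [::] F (c i)).
Definition block_point c := expansion_value beta (block_stream c).

Context (c : nat -> nat) (hc : forall i, (c i < size F)%N).

Lemma block_mem i : nth [::] F (c i) \in F. Proof. exact: mem_nth. Qed.

Lemma block_av i : av 0 (nth [::] F (c i)).
Proof. by have [/aboveP[]] := Fabove (block_mem i). Qed.

Lemma block_point_shift q :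
  block_point (fun i => c (q + i)%N) =
  branch (nth [::] F (c q)) (block_point (fun i => c (q.+1 + i)%N)).
Proof.
rewrite /block_point {1}(expansion_valueD b1 n).
rewrite /block_stream mkseq_cat_stream addn0; last by case: (Fabove (block_mem q)).
have := seq_shift_cat_stream (fun i => nth [::] F (c (q + i)%N)) 1 n0.
rewrite mul1n => ->; congr (branch _ (expansion_value _ (cat_stream _ _))).
by apply/funext => i; rewrite addnA addn1.
Qed.

Lemma block_point_le : block_point c <= 1 / beta.
Proof.
apply: expansion_value_le => // k; rewrite ltW // -ones_value1.
apply: (branch_lt_ones b1 hm (leq0n m)); last by rewrite lexx divr_gt0.
apply: bounded_runs_cat_stream => // i; split; last exact: block_av.
by case: (Fabove (block_mem i)).
Qed.

Lemma block_stream_prefix k :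
  block_point c = branch (mkseq (block_stream c) (k * n)) (block_point (fun i => c (k + i)%N)).
Proof.
by rewrite /block_point (expansion_valueD b1 (k * n)) seq_shift_cat_stream.
Qed.

End Stream.

Section Points.
Context (t : R) (n : nat) (n0 : (0 < n)%N) (F : seq (seq bool)).
Context (Fabove : forall w, w \in F ->
  [/\ above t w, size w = n & branch w (1 / beta) < 1 / beta]).
Local Notation pt := (block_point n F).
Implicit Types c : nat -> nat.

(** The first block contains a digit 1, whence the lower bound; the condition on
    [branch w (1 / beta)] in [Fabove] makes the upper bound strict, as is needed to put words in
    front. *)
Lemma block_point_bounds c : (forall i, (c i < size F)%N) ->
  (beta ^+ n)^-1 <= pt c < 1 / beta.
Proof.
move=> hc; have e := block_point_shift n0 Fabove hc 0.
have -> : pt c = branch (nth [::] F (c 0%N)) (pt (fun i => c (1 + i)%N)) by [].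
have [/aboveP[a g] sw lw] := Fabove (block_mem hc 0).
have p0 : 0 <= pt (fun i => c (1 + i)%N) by apply: expansion_value_ge0.
apply/andP; split.
  have := g 0%N; rewrite sw drop0 => /(_ n0)/(word_gt_branch_ge b1); rewrite sw.
  by move=> /le_trans; apply; rewrite ler_branch.
apply: le_lt_trans lw; rewrite ler_branch //.
by apply: (block_point_le n0 Fabove).
Qed.

(** Every iterate starts with a nonempty suffix of a block, and these lie above [t]. *)
Lemma iter_block_point c l : (forall i, (c i < size F)%N) ->
  exists w y, [/\ gt w t, (size w <= n)%N, 0 <= y & iter l T (pt c) = branch w y].
Proof.
move=> hc.
have hcq q : forall i, (c (q + i)%N < size F)%N by [].
have step q r : (r <= n)%N -> iter r T (pt (fun i => c (q + i)%N)) =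
    branch (drop r (nth [::] F (c q))) (pt (fun i => c (q.+1 + i)%N)).
  move=> rn; rewrite (block_point_shift n0 Fabove hc).
  have [_ sw _] := Fabove (block_mem hc q).
  apply: (iter_branch b1 b2 hm (leq0n m) (block_av Fabove hc q)); last by rewrite sw.
  by have /andP[h ->] := block_point_bounds (hcq q.+1); rewrite (le_trans _ h) // invr_ge0 exprn_ge0 // ltW.
have main q : iter (q * n) T (pt c) = pt (fun i => c (q + i)%N).
  elim: q => [//|q IH]; rewrite mulSn iterD IH step // drop_oversize //.
  by have [_ -> _] := Fabove (block_mem hc q).
have [/aboveP[_ g] sw _] := Fabove (block_mem hc (l %/ n)%N).
exists (drop (l %% n)%N (nth [::] F (c (l %/ n)%N))), (pt (fun i => c ((l %/ n)%N.+1 + i)%N)).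
split.
- by apply: g; rewrite sw ltn_mod.
- by rewrite size_drop sw leq_subr.
- exact: expansion_value_ge0.
- rewrite -step; last by rewrite ltnW // ltn_mod.
  by rewrite -main -iterD addnC -divn_eq.
Qed.

(** After the [j] common blocks are removed, [branch_sep] applies to the two differing blocks, with
    [kappa = beta ^- n] as lower bound for the tails. *)
Lemma block_point_sep c c' j : uniq F ->
  (forall i, (c i < size F)%N) -> (forall i, (c' i < size F)%N) ->
  (forall i, (i < j)%N -> c i = c' i) -> c j <> c' j ->
  (beta ^+ n)^-1 / beta ^+ n * ((beta ^+ n)^-1) ^+ j <= `|pt c - pt c'|.
Proof.
move=> uF hc hc' e cj.
rewrite (block_stream_prefix n0 F c j) (block_stream_prefix n0 F c' j).
have -> : mkseq (block_stream n F c') (j * n) = mkseq (block_stream n F c) (j * n).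
  apply/eq_in_map => i; rewrite mem_iota /= add0n => ij.
  by rewrite /block_stream /cat_stream e // ltn_divLR.
rewrite norm_branchB // size_mkseq mulnC exprM exprVn ler_pM2r ?invr_gt0 ?exprn_gt0 //.
rewrite (block_point_shift n0 Fabove hc) (block_point_shift n0 Fabove hc').
have [/aboveP[a _] sw _] := Fabove (block_mem hc j).
have [/aboveP[a' _] sw' _] := Fabove (block_mem hc' j).
rewrite -{2}sw; apply: branch_sep; rewrite ?sw ?sw' //.
- by rewrite invr_ge0 exprn_ge0 // ltW.
- by have /andP[-> /ltW ->] := @block_point_bounds (fun i => c (j.+1 + i)%N) (fun i => hc _).
- by have /andP[-> /ltW ->] := @block_point_bounds (fun i => c' (j.+1 + i)%N) (fun i => hc' _).
- exact: bounded_runs_le a.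
- exact: bounded_runs_le a'.
- by move=> /eqP; rewrite nth_uniq // => /eqP.
Qed.

End Points.

(** The suffix follows the digits of [iter i T t] up to the raised one, so it lies above this
    iterate, which is at least [t]. *)
Lemma raised_word_gt t k i : self_survivor beta t -> ~~ digit beta (iter k T t) ->
  (i <= k)%N -> gt (drop i (rcons (itin k t) true)) t.
Proof.
move=> [ht tT] dk ik.
rewrite -cats1 drop_cat size_itinerary; case: ltnP => [{}ik|ki].
  rewrite drop_itinerary.
  apply: (word_gt_le b1 b2 ht (iter_beta_transform_bounds beta i ht) (tT i)).
  by rewrite word_gt_itinerary_cat -iterD subnK ?(ltnW ik) //= (negbTE dk).
have -> : i = k by apply/eqP; rewrite eqn_leq ik.
rewrite subnn drop0.
apply: (word_gt_le b1 b2 ht (iter_beta_transform_bounds beta k ht) (tT k)).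
by rewrite /= (negbTE dk).
Qed.

Lemma raised_word_av t k : 0 <= t < 1 -> (0 < run_state m m (itin k t))%N ->
  av m (rcons (itin k t) true).
Proof.
move=> ht sk; rewrite -cats1 bounded_runs_cat itinerary_av //=.
by case: (run_state _ _ _) sk.
Qed.

Lemma self_survivor_digit0 t : self_survivor beta t -> digit beta t = false.
Proof.
move=> st; apply/negbTE; rewrite digit_ge_val // -ltNge.
apply: lt_trans (self_survivor_lt b1 b2 hm st) _.
by rewrite ltrBlDr -mulrDl ltr_pdivlMr // mul1r; have := b2; lra.
Qed.

Lemma raised_word_above t k : self_survivor beta t -> (0 < k)%N ->
  ~~ digit beta (iter k T t) -> (0 < run_state m m (itin k t))%N ->
  above t (rcons (itin k t) true).
Proof.
move=> st k0 dk sk; have [ht _] := st; apply/aboveP; split.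
  have := raised_word_av ht sk; case: k k0 {dk sk} => //= k _.
  by rewrite self_survivor_digit0.
move=> i; rewrite size_rcons size_itinerary ltnS => ik.
exact: raised_word_gt.
Qed.

(** The points [x] and [t] share [k] digits, so words of length at most [k] compare alike with both.
    Every later iterate of [x] starts with such a word above [t], hence above [x]. *)
Lemma raised_block_point t k n F c : self_survivor beta t -> (n <= k)%N -> (0 < n)%N ->
  ~~ digit beta (iter k T t) -> (0 < run_state m m (itin k t))%N ->
  (forall w, w \in F ->
    [/\ above t w, size w = n & branch w (1 / beta) < 1 / beta]) ->
  (forall i, (c i < size F)%N) ->
  let x := branch (rcons (itin k t) true) (block_point n F c) in
  self_survivor beta x /\ t < x < t + (beta ^+ k)^-1.
Proof.
move=> st nk n0 dk sk hF hc; have [ht tT] := st.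
set z := rcons _ _; set y := block_point n F c.
have az : av m z by apply: raised_word_av.
have sz : size z = k.+1 by rewrite size_rcons size_itinerary.
have hy : 0 <= y < 1 / beta.
  have /andP[h ->] := block_point_bounds n0 hF hc.
  by rewrite (le_trans _ h) // invr_ge0 exprn_ge0 // ltW.
have y0 : 0 <= y by case/andP: hy.
move=> x.
have hx : 0 <= x < 1 by apply: (branch_bounds b1 hm (leqnn m) az hy).
have it i : (i <= k.+1)%N -> iter i T x = branch (drop i z) y.
  by rewrite -sz; apply: (iter_branch b1 b2 hm (leqnn m) az hy).
have ex : itin k x = itin k t.
  have := itinerary_branch b1 b2 hm 0 (leqnn m) az hy; rewrite addn0 cats0 sz.
  rewrite -/x itineraryS /z => /eqP; rewrite eqseq_rcons => /andP[/eqP -> _].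
  by [].
have gz i : (i <= k)%N -> gt (drop i z) t by move=> ik; apply: raised_word_gt.
have tx : t < x by have := word_gt_branch b1 b2 ht y0 (gz 0%N isT); rewrite drop0.
split; last first.
  rewrite tx /= -ltrBlDl; apply: le_lt_trans (ler_norm _) _.
  exact: (itinerary_norm_lt b1 b2).
split=> // i; have gx w : (size w <= k)%N -> gt w t -> gt w x.
  by move=> wk; rewrite (word_gt_same_digits ex wk).
case: i => [//|i]; have [ik|ki] := ltnP i k.
  rewrite it 1?ltnW //; apply/ltW/word_gt_branch => //; apply: gx; last exact: gz.
  by rewrite size_drop sz subSS leq_subr.
have -> : iter i.+1 T x = iter (i - k) T y.
  rewrite -(subnK ki) -addnS addnK iterD it // drop_oversize ?sz //.
have [w [y' [gw wn y'0 ->]]] := iter_block_point n0 hF (i - k) hc.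
by apply/ltW/word_gt_branch => //; apply: gx => //; apply: leq_trans nk.
Qed.

(** By [branch_sep] the branches of two distinct words cannot both attain the maximum [1 / beta] at
    [1 / beta], so the strict condition discards at most one word. *)
Lemma raised_blocks_size t n :
  (size (above_words t n) <=
   (size [seq w <- above_words t n | (branch w (1 / beta) < 1 / beta)%R]).+1)%N.
Proof.
set P := fun w => (branch w (1 / beta) < 1 / beta)%R.
rewrite -(count_predC P (above_words t n)) size_filter -addn1 leq_add2l -size_filter.
set s := [seq _ <- _ | _].
have us : uniq s by rewrite filter_uniq // above_words_uniq.
have inj w w' : w \in s -> w' \in s -> w = w'.
  rewrite !(mem_filter (predC P)) !mem_above_words /= -!leNgt.
  move=> /and3P[h1 /aboveP[a1 _] /eqP s1] /and3P[h2 /aboveP[a2 _] /eqP s2].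
  have bb : 0 <= 1 / beta <= 1 / beta by rewrite lexx divr_ge0 // ltW.
  have e1 := branch_le_ones b1 hm (leq0n m) a1 bb.
  have e2 := branch_le_ones b1 hm (leq0n m) a2 bb.
  rewrite ones_value1 in e1 e2.
  have e : branch w (1 / beta) = branch w' (1 / beta).
    by apply/eqP; rewrite eq_le (le_trans e1 h2) (le_trans e2 h1).
  apply: contrapT => ww'.
  have k0 : 0 < 1 / beta by rewrite divr_gt0.
  have bk : 1 / beta <= 1 / beta <= 1 / beta by rewrite lexx.
  have := branch_sep (ltW k0) bk bk (etrans s1 (esym s2))
    (bounded_runs_le (leq0n m) a1) (bounded_runs_le (leq0n m) a2) ww'.
  by rewrite e subrr normr0 leNgt divr_gt0 // exprn_gt0.
case: s us inj => [//|w [//|w' s]] /= + inj.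
by rewrite (inj w w') ?inE ?eqxx ?orbT.
Qed.

(** The summand 1 pays for the discarded word; the Cantor set has [size F] pieces of ratio
    [beta ^- n]. *)
Lemma dim_self_survivor_ge t r n sigma : self_survivor beta t -> 0 < r ->
  (0 < n)%N -> 0 < sigma ->
  1 + beta `^ sigma ^+ n <= (size (above_words t n))%:R ->
  (sigma%:E <= hausdorff_dim ([set x | self_survivor beta x] `&` `]t, (t + r)%R[))%E.
Proof.
move=> st r0 n0 s0 hW; have [ht _] := st.
pose F := [seq w <- above_words t n | (branch w (1 / beta) < 1 / beta)%R].
have hF w : w \in F -> [/\ above t w, size w = n & branch w (1 / beta) < 1 / beta].
  by rewrite mem_filter mem_above_words => /and3P[? ? /eqP ?].
have uF : uniq F by rewrite filter_uniq // above_words_uniq.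
have hN : beta `^ sigma ^+ n <= (size F)%:R.
  have := raised_blocks_size t n; rewrite -/F -(ler_nat R) -natr1 => h.
  by have := le_trans hW h; rewrite addrC lerD2r.
have l1 : 1 < beta `^ sigma by apply: powR_gt1.
have N1 : (1 < size F)%N.
  by rewrite -(ltr_nat R); apply: lt_le_trans hN; rewrite exprn_egt1 // -lt0n.
have [k1 _ hk1] := linear_lt_exp r^-1 0 b1.
(* [k >= n] lets blocks be compared with [x], and [k >= k1] keeps [x] within [r] of [t]. *)
have [k kk [dk sk]] := raisable_digit b1 b2 hm (maxn n k1) ht.
have nk : (n <= k)%N by apply: leq_trans kk; rewrite leq_maxl.
have kr : (beta ^+ k)^-1 <= r.
  rewrite -[leRHS]invrK lef_pV2 ?posrE ?invr_gt0 ?exprn_gt0 //.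
  apply: (@le_trans _ _ (beta ^+ k1)); last first.
    by rewrite ler_eXn2l // (leq_trans _ kk) // leq_maxr.
  by apply: le_trans (ltW hk1); rewrite ler_peMr ?ler1n // invr_ge0 ltW.
pose z := rcons (itin k t) true.
pose kappa := (beta ^+ n)^-1 / beta ^+ n / beta ^+ size z.
apply: (@hausdorff_dim_ge _ _ (size F) ((beta ^+ n)^-1) kappa sigma
  (fun c => branch z (block_point n F c))) => //.
- by rewrite invr_gt0 exprn_gt0 // invf_le1 ?exprn_gt0 // exprn_ege1 // ltW.
- by rewrite !divr_gt0 ?invr_gt0 ?exprn_gt0.
- rewrite (powR_exprVn n sigma (ltW b0)) ler_pdivlMr ?exprn_gt0 ?powR_gt0 //.
  by rewrite mul1r.
- move=> c hc; have [sx /andP[tx xt]] := raised_block_point st nk n0 dk sk hF hc.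
  split=> //=; rewrite in_itv /= tx /=; apply: lt_le_trans xt _.
  by rewrite lerD2l.
- move=> c c' j hc hc' e cj; rewrite norm_branchB // mulrAC.
  rewrite ler_pM2r ?invr_gt0 ?exprn_gt0 //.
  exact: (block_point_sep n0 hF uF hc hc' e cj).
Qed.

End Lower.

(** * Strict decrease of the dimension *)

Lemma ler_sum_subseq (R : numDomainType) (I : eqType) (s s' : seq I) (f : I -> R) :
  uniq s -> uniq s' -> {subset s <= s'} -> (forall i, 0 <= f i) ->
  \sum_(i <- s) f i <= \sum_(i <- s') f i.
Proof.
move=> us us' ss' f0; rewrite [leRHS](bigID (mem s)) /=.
have -> : \sum_(i <- s' | i \in s) f i = \sum_(i <- s) f i.
  rewrite -big_filter; apply: perm_big; apply: uniq_perm => // [|x].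
    exact: filter_uniq.
  by rewrite mem_filter; case: (boolP (x \in s)) => // /ss' ->.
by rewrite lerDl sumr_ge0.
Qed.

Section Drop.
Context (R : realType) (beta : R) (b1 : 1 < beta) (b2 : beta < 2).
Context (m : nat) (hm : ones_value beta m.+1 = 1).
Implicit Types (x y t : R) (s w u v : seq bool) (n k i j : nat).
Local Notation T := (beta_transform beta).
Local Notation itin := (itinerary beta).
Local Notation branch := (branch beta).
Local Notation av := (bounded_runs m).
Local Notation gt := (word_gt beta).
Local Notation lt := (word_lt beta).
Local Notation above := (above beta m).
Local Notation above_words := (above_words beta m).
Local Notation upto := (above_words_upto beta m).
Local Notation allowed_words := (allowed_words beta m).
Let b0 : 0 < beta. Proof. exact: lt_trans b1. Qed.

Fixpoint interleave s_words v j : seq (seq bool) :=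
  if j is j'.+1 then [seq u ++ v ++ w | u <- s_words, w <- interleave s_words v j']
  else s_words.

Lemma interleave_above t t' v M j w : 0 <= t < 1 -> 0 <= t' < 1 -> t <= t' ->
  above t v -> w \in interleave (upto t' M) v j ->
  above t w && (size w <= j.+1 * M + j * size v)%N.
Proof.
move=> ht ht' tt' av_v; elim: j w => [|j IH] w /=.
  rewrite mem_above_words_upto mul1n mul0n addn0 => /andP[a ->].
  by rewrite (above_le b1 b2 ht ht' tt' a).
move=> /allpairsP[[u x] /= [+ /IH/andP[ax sx] ->]].
rewrite mem_above_words_upto => /andP[/(above_le b1 b2 ht ht' tt') au su].
rewrite above_cat // ?above_cat //= !size_cat.
by rewrite (mulSn j.+1) (mulSn j) -addnA leq_add // addnCA leq_add2l.
Qed.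

(* A word of [upto t' M] is above [t'] in each of its suffixes while [v] is
   below [t'], so the first marker [v] can be read off the concatenation. *)
Lemma interleave_uniq t' v M j : lt v t' -> uniq (interleave (upto t' M) v j).
Proof.
move=> vt; have uS := above_words_upto_uniq beta m t' M.
have dec u u' w w' : u \in upto t' M -> u' \in upto t' M ->
    u ++ v ++ w = u' ++ v ++ w' -> (size u' <= size u)%N.
  rewrite !mem_above_words_upto => /andP[au _] /andP[/aboveP[_ gu'] _] e.
  rewrite leqNgt; apply/negP => h.
  have := congr1 (drop (size u)) e; rewrite drop_size_cat // drop_cat h => e'.
  have := word_gt_not_lt (word_gt_cat (v ++ w') (gu' _ h)).
  by rewrite -e' word_lt_cat.
elim: j => [//|j IH] /=; apply: allpairs_uniq => //.
move=> _ _ /allpairsP[[u x] /= [hu hx ->]] /allpairsP[[u' x'] /= [hu' hx' ->]] /= e.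
have sz : size u = size u'.
  by apply/eqP; rewrite eqn_leq (dec _ _ _ _ hu' hu (esym e)) (dec _ _ _ _ hu hu' e).
have eu : u = u' by have := congr1 (take (size u)) e; rewrite {2}sz !take_size_cat.
move: e; rewrite eu => /(congr1 (drop (size u'))); rewrite !drop_size_cat //.
by move=> /(congr1 (drop (size v))); rewrite !drop_size_cat // => ->.
Qed.

Section Weight.
Context (lambda : R) (l1 : 1 < lambda).
Let l0 : 0 < lambda. Proof. exact: lt_trans l1. Qed.

(** The generating function of the lengths at [1 / lambda], multiplicative under concatenation. *)
Definition weight (s_words : seq (seq bool)) : R := \sum_(w <- s_words) (lambda ^+ size w)^-1.

Lemma weight_interleave s_words v j :
  weight (interleave s_words v j) =
  weight s_words * (weight s_words / lambda ^+ size v) ^+ j.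
Proof.
elim: j => [|j IH] /=; first by rewrite expr0 mulr1.
rewrite /weight big_allpairs_dep /= -/(weight _).
under eq_bigr => u _.
  under eq_bigr => x _ do rewrite !size_cat !exprD !invfM.
  rewrite -mulr_sumr -mulr_sumr -/(weight _) IH; over.
by rewrite -mulr_suml -/(weight _) exprS; ring.
Qed.

Lemma weight_upto t n :
  weight (upto t n) = \sum_(k < n.+1) (size (above_words t k))%:R / lambda ^+ k.
Proof. exact: (sum_above_words_upto beta m t n (fun k => (lambda ^+ k)^-1)). Qed.

Lemma weight_upto_le t n :
  (forall k, (size (above_words t k))%:R <= 1 + lambda ^+ k) ->
  weight (upto t n) <= 2 * n.+1%:R.
Proof.
move=> h; rewrite weight_upto; apply: (@le_trans _ _ (\sum_(k < n.+1) 2)).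
  apply: ler_sum => k _; rewrite ler_pdivrMr ?exprn_gt0 //.
  apply: le_trans (h _) _; rewrite mulrDl mul1r lerD2r exprn_ege1 //.
  exact: ltW.
by rewrite sumr_const card_ord mulr_natr.
Qed.

(** Summation by parts: with [a n] the cumulative count over [lambda ^+ n], the difference
    [weight - a n] grows at step [n] by [(1 - lambda^-1) * a n], and [a n] is at least
    [1 / (m + 1)]. *)
Lemma weight_upto_unbounded t : self_survivor beta t ->
  (forall n, lambda ^+ n <= (size (allowed_words t n))%:R) ->
  forall B, exists M, B <= weight (upto t M).
Proof.
move=> st hL B.
pose a n : R := (size (upto t n))%:R / lambda ^+ n.
pose e := (1 - lambda^-1) / m.+1%:R.
have e0 : 0 < e by rewrite divr_gt0 ?ltr0n // subr_gt0 invf_lt1.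
have ha n : (m.+1%:R)^-1 <= a n.
  rewrite /a ler_pdivlMr ?exprn_gt0 // mulrC ler_pdivrMr ?ltr0n //.
  apply: le_trans (hL n) _; rewrite -natrM ler_nat mulnC.
  exact: size_allowed_words_le.
have step n : e * n%:R <= weight (upto t n) - a n.
  elim: n => [|n IH].
    by rewrite mulr0 weight_upto /a size_above_words_upto expr0 divr1 subr_ge0;
      apply: ler_sum => i _; rewrite ord1 expr0 divr1.
  have -> : weight (upto t n.+1) - a n.+1 =
      (weight (upto t n) - a n) + (1 - lambda^-1) * a n.
    have -> : weight (upto t n.+1) = weight (upto t n) +
        (size (above_words t n.+1))%:R / lambda ^+ n.+1.
      by rewrite !weight_upto big_ord_recr.
    rewrite /a [upto t n.+1]/= size_cat natrD exprS; field.
    by rewrite expf_neq0 gt_eqF.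
  rewrite -natr1 mulrDr mulr1; apply: lerD => //.
  by rewrite /e ler_pM2l // subr_gt0 invf_lt1.
exists (Num.Def.trunc (B / e)).+1; apply: (@le_trans _ _ (e * (Num.Def.trunc (B / e)).+1%:R)).
  by rewrite mulrC -ler_pdivrMr // ltW // truncnS_gt.
apply: le_trans (step _) _; rewrite gerBl.
by rewrite divr_ge0 ?exprn_ge0 // ltW.
Qed.

(** Otherwise the weight of the interleaved words would grow exponentially in [j], while they are
    words above [t] of length linear in [j], whose total weight is at most linear. *)
Lemma allowed_words_small t t' : self_survivor beta t -> self_survivor beta t' ->
  t < t' -> (forall n, (size (above_words t n))%:R <= 1 + lambda ^+ n) ->
  exists n, (size (allowed_words t' n))%:R < lambda ^+ n.
Proof.
move=> st st' tt' hW; have [ht _] := st; have [ht' _] := st'.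
apply: contrapT => /forallNP hL.
have {}hL n : lambda ^+ n <= (size (allowed_words t' n))%:R.
  by rewrite leNgt; apply/negP.
have [p hp] := word_lt_exists b1 b2 ht ht' tt'.
(* Raising a digit after position [p] keeps the prefix of [t] on which [t] is already below [t']. *)
have [k kp [dk sk]] := raisable_digit b1 b2 hm p.+1 ht.
set v := rcons (itin k t) true.
have av_v : above t v by apply: (raised_word_above b1 b2 hm st) => //; apply: leq_trans kp.
have vt : lt v t'.
  by rewrite /v -cats1 -(subnKC (ltnW kp)) itineraryD -catA; apply: word_lt_cat.
(* With this bound each further marker [v] at least doubles the weight. *)
have [M hM] := weight_upto_unbounded st' hL (2 * lambda ^+ size v).
set F := weight _ in hM.
have Fb j : F * (F / lambda ^+ size v) ^+ j <= 2 * (j.+1 * M + j * size v).+1%:R.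
  rewrite -weight_interleave; apply: le_trans (weight_upto_le _ hW).
  apply: ler_sum_subseq.
  - exact: interleave_uniq.
  - exact: above_words_upto_uniq.
  - move=> w /(interleave_above ht ht' (ltW tt') av_v).
    by rewrite mem_above_words_upto.
  - by move=> w; rewrite invr_ge0 exprn_ge0 // ltW.
have two : (1 : R) < 2 by rewrite ltr1n.
have [j _ hj] := linear_lt_exp (2 * (M + size v).+1%:R) 0 two.
have := Fb j; rewrite leNgt => /negP; apply.
have lv : 1 <= lambda ^+ size v by rewrite exprn_ege1 // ltW.
have F1 : 1 <= F by apply: le_trans hM; lra.
apply: (@le_lt_trans _ _ (2 * (M + size v).+1%:R * j.+1%:R)).
  rewrite -mulrA ler_pM2l // -natrM ler_nat.
  apply: (@leq_trans ((j.+1 * M + j * size v).+1 + (size v + j))%N).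
    exact: leq_addr.
  by apply/eq_leq; ring.
apply: lt_le_trans hj _; apply: (@le_trans _ _ ((F / lambda ^+ size v) ^+ j)).
  rewrite lerXn2r // ?nnegrE ?divr_ge0 ?exprn_ge0 ?(ltW l0) ?(le_trans _ F1) //.
  by rewrite ler_pdivlMr ?exprn_gt0.
rewrite ler_peMl // exprn_ge0 // divr_ge0 ?exprn_ge0 ?(ltW l0) //.
exact: le_trans F1.
Qed.

End Weight.

Lemma powR_root (mu : R) n : 1 < mu -> (0 < n)%N ->
  exists2 sigma, 0 < sigma & beta `^ sigma ^+ n = mu.
Proof.
move=> mu1 n0; have lb : 0 < ln beta by apply: ln_gt0.
have nR : 0 < n%:R :> R by rewrite ltr0n.
exists (ln mu / (n%:R * ln beta)); first by rewrite divr_gt0 ?mulr_gt0 // ln_gt0.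
rewrite -powR_mulrn ?powR_ge0 // -powRrM.
have mu0 : 0 < mu by apply: lt_trans mu1.
apply: ln_inj; rewrite ?posrE ?powR_gt0 //.
by rewrite ln_powR; field; rewrite !gt_eqF.
Qed.

Lemma powR_expn_le (s s' : R) n : s <= s' -> beta `^ s ^+ n <= beta `^ s' ^+ n.
Proof.
move=> ss'; rewrite lerXn2r ?nnegrE ?powR_ge0 //.
by apply: ler_powR; rewrite ?(ltW b1).
Qed.

Lemma powR_ge1 (s : R) : 0 <= s -> 1 <= beta `^ s.
Proof. by move=> s0; rewrite -(powRr0 beta) ler_powR ?(ltW b1). Qed.

Lemma size_above_words0 t : (size (above_words t 0) <= 1)%N.
Proof.
by rewrite size_filter (leq_trans (count_size _ _)) // size_map -cardE card_tuple.
Qed.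

(** A larger count at one length would give, by [dim_self_survivor_ge], an exponent above [d]. *)
Lemma above_words_le_dim t r d : self_survivor beta t -> 0 < r -> 0 <= d ->
  (hausdorff_dim ([set x | self_survivor beta x] `&` `]t, (t + r)%R[) <= d%:E)%E ->
  forall n, (size (above_words t n))%:R <= 1 + beta `^ d ^+ n.
Proof.
move=> st r0 d0 hd [|n].
  rewrite expr0; apply: (@le_trans _ _ 1); last by rewrite lerDl.
  by rewrite lern1 size_above_words0.
rewrite leNgt; apply/negP => h.
have h1 : beta `^ d ^+ n.+1 < (size (above_words t n.+1))%:R - 1 by rewrite ltrBrDl.
have mu1 : 1 < (size (above_words t n.+1))%:R - 1 :> R.
  by apply: le_lt_trans h1; rewrite exprn_ege1 // powR_ge1.
have [sigma s0 es] := powR_root mu1 (ltn0Sn n).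
have : (sigma%:E <= d%:E)%E.
  apply: le_trans hd; apply: (dim_self_survivor_ge b1 b2 hm st r0 (ltn0Sn n) s0).
  by rewrite es addrCA subrr addr0.
rewrite lee_fin => /(powR_expn_le n.+1); rewrite es leNgt.
by rewrite h1.
Qed.

Lemma survivor_dim_le_above t d : self_survivor beta t -> 0 <= d ->
  (forall n, (size (above_words t n))%:R <= 1 + beta `^ d ^+ n) ->
  (hausdorff_dim (survivor beta t) <= d%:E)%E.
Proof.
move=> st d0 h; have [ht _] := st; apply/lee_addgt0Pr => e e0; rewrite -EFinD.
have q1 : 1 < beta `^ e by apply: powR_gt1.
have [n n0 hn] := linear_lt_exp (2 * m.+1%:R) 1 q1.
apply: (survivor_dim_le b1 b2 hm (n := n)) => //.
  by rewrite addr_ge0 // ltW.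
have := size_allowed_words_le b1 b2 m n st; rewrite -(ler_nat R) => /le_trans; apply.
rewrite natrM size_above_words_upto powRD; last by apply/implyP => _; rewrite gt_eqF.
rewrite exprMn mulrC.
apply: (@le_trans _ _ (2 * n.+1%:R * beta `^ d ^+ n * m.+1%:R)).
  rewrite ler_pM2r ?ltr0n // -mulrA mulrCA mulrC.
  apply: (@le_trans _ _ (\sum_(k < n.+1) 2 * beta `^ d ^+ n)).
    apply: ler_sum => k _; apply: le_trans (h _) _.
    have kn : beta `^ d ^+ k <= beta `^ d ^+ n.
      by apply: ler_weXn2l; [exact: powR_ge1|rewrite -ltnS].
    have k1 : 1 <= beta `^ d ^+ k by rewrite exprn_ege1 // powR_ge1.
    lra.
  by rewrite sumr_const card_ord mulr_natr mulrC.
have -> : 2 * n.+1%:R * beta `^ d ^+ n * m.+1%:R =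
    beta `^ d ^+ n * (2 * m.+1%:R * n.+1%:R) by ring.
by rewrite ler_pM2l ?exprn_gt0 ?powR_gt0 // ltW.
Qed.

Lemma survivor_dim_fin t : 0 <= t < 1 -> exists2 d, 0 <= d &
  hausdorff_dim (survivor beta t) = d%:E.
Proof.
move=> ht; have two : (1 : R) < 2 by rewrite ltr1n.
have [s s0 es] := powR_root two (ltn0Sn 0).
have := survivor_dim_le b1 b2 hm (n := 1) (sigma := s) ht (ltn0Sn 0) (ltW s0).
have := hausdorff_dim_ge0 (survivor beta t).
rewrite es => h0 h; have {}h : (hausdorff_dim (survivor beta t) <= s%:E)%E.
  apply: h; rewrite ler_nat size_filter (leq_trans (count_size _ _)) //.
  by rewrite size_map -cardE card_tuple card_bool.
case: (hausdorff_dim _) h h0 => [d| |] //= _; rewrite lee_fin => d0.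
by exists d.
Qed.

Lemma self_survivor_near_sub t r :
  [set x | self_survivor beta x] `&` `]t, (t + r)%R[ `<=` survivor beta t.
Proof.
move=> x [/= [hx hT]]; rewrite in_itv /= => /andP[tx _]; split=> // n.
by rewrite (le_trans (ltW tx)).
Qed.

(** The local dimension bounds the counts of words above [t], and these bound the dimension of the
    survivor set. *)
Lemma dim_self_survivor_near t r : self_survivor beta t -> 0 < r ->
  hausdorff_dim ([set x | self_survivor beta x] `&` `]t, (t + r)%R[) =
  hausdorff_dim (survivor beta t).
Proof.
move=> st r0; have [ht _] := st; apply/eqP; rewrite eq_le.
have le1 := hausdorff_dim_mono (@self_survivor_near_sub t r).
rewrite le1 /=.
have [d d0 ed] := survivor_dim_fin ht.
have := hausdorff_dim_ge0 ([set x | self_survivor beta x] `&` `]t, (t + r)%R[).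
move: le1; rewrite {1}ed; case eX : (hausdorff_dim (_ `&` _)) => [e| |] //= _.
rewrite lee_fin => e0; apply: survivor_dim_le_above => //.
by apply: (above_words_le_dim st r0 e0); rewrite eX.
Qed.

(** Three arrangements of [u], [u], [v] have equal length and differ because neither of [u], [v] is
    a prefix of the other. Three words leave two after the loss of one, enough for a positive
    dimension. *)
Lemma three_above_words t : self_survivor beta t ->
  exists2 n, (0 < n)%N & (3 <= size (above_words t n))%N.
Proof.
move=> st; have [ht _] := st.
have [k k0 [dk sk]] := raisable_digit b1 b2 hm 1 ht.
have [l kl [dl sl]] := raisable_digit b1 b2 hm k.+1 ht.
set u := rcons (itin k t) true; set v := rcons (itin l t) true.
have au : above t u by apply: (raised_word_above b1 b2 hm st).
have a_v : above t v by apply: (raised_word_above b1 b2 hm st) => //; apply: leq_trans kl.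
have su : size u = k.+1 by rewrite size_rcons size_itinerary.
have tv w : take k.+1 (v ++ w) = rcons (itin k t) false.
  rewrite take_cat size_rcons size_itinerary ltnS kl.
  rewrite /v -cats1 takel_cat ?size_itinerary // take_itinerary // itineraryS.
  by rewrite (negbTE dk).
have uv (w1 w2 : seq bool) : v ++ w1 <> u ++ w2.
  move=> e; have := congr1 (take k.+1) e; rewrite tv -su take_size_cat // => /eqP.
  by rewrite eqseq_rcons andbF.
exists (k.+1 + k.+1 + size v)%N; first by rewrite addSn.
apply: (@uniq_leq_size _ [:: u ++ u ++ v; u ++ v ++ u; v ++ u ++ u]).
  rewrite /= !inE !negb_or andbT; apply/andP; split; first (apply/andP; split).
  - apply/eqP => /eqP; rewrite eqseq_cat // eqxx /= => /eqP.
    by move=> /esym; apply: uv.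
  - by apply/eqP => /esym; apply: uv.
  - by apply/eqP => /esym; apply: uv.
move=> w; rewrite !inE mem_above_words.
by case/or3P => /eqP ->; rewrite !above_cat //= !size_cat su; apply/eqP; ring.
Qed.

Lemma survivor_dim_gt0 t : self_survivor beta t ->
  (0 < hausdorff_dim (survivor beta t))%E.
Proof.
move=> st; have [n n0 h3] := three_above_words st.
have two : (1 : R) < 2 by rewrite ltr1n.
have [s s0 es] := powR_root two n0.
rewrite -(dim_self_survivor_near st ltr01).
apply: (@lt_le_trans _ _ s%:E); first by rewrite lte_fin.
apply: (dim_self_survivor_ge b1 b2 hm st ltr01 n0 s0).
by rewrite es -[1 + 2](natrD R 1 2) ler_nat.
Qed.

Lemma hausdorff_dim_set0 : hausdorff_dim (set0 : set R) = 0%E.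
Proof.
apply/eqP; rewrite eq_le hausdorff_dim_ge0 andbT; apply: hausdorff_dim_le => //.
move=> s delta e s0 d0 e0; exists 0%N, (fun=> set0), delta.
by split=> //; rewrite mul0r ltW.
Qed.

Lemma survivor_dim_lt t t' : self_survivor beta t -> t < t' < 1 ->
  (hausdorff_dim (survivor beta t') < hausdorff_dim (survivor beta t))%E.
Proof.
move=> st /andP[tt' t'1]; have [ht _] := st.
have r0 : 0 < t' - t by rewrite subr_gt0.
(* Positive local dimension supplies a self-surviving [x] between [t] and [t'], so it suffices to
   drop from [t] to [x]. *)
have [x [sx]] : [set x | self_survivor beta x] `&` `]t, (t + (t' - t))%R[ !=set0.
  apply/set0P/eqP => e; have := survivor_dim_gt0 st.
  by rewrite -(dim_self_survivor_near st r0) e hausdorff_dim_set0 ltxx.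
rewrite /= in_itv /= addrCA subrr addr0 => /andP[tx xt'].
have [hx _] := sx.
apply: (@le_lt_trans _ _ (hausdorff_dim (survivor beta x))).
  apply: hausdorff_dim_mono => y [hy hT]; split=> // n.
  by rewrite (le_trans (ltW xt')).
have [d d0 ed] := survivor_dim_fin ht.
have dgt0 : 0 < d by have := survivor_dim_gt0 st; rewrite ed lte_fin.
have l1 : 1 < beta `^ d by apply: powR_gt1.
have hW : forall n, (size (above_words t n))%:R <= 1 + beta `^ d ^+ n.
  by apply: (above_words_le_dim st ltr01 d0); rewrite (dim_self_survivor_near st ltr01) ed.
have [n hn] := allowed_words_small l1 st sx tx hW.
have n0 : (0 < n)%N.
  case: n hn => // ; rewrite expr0 ltNge ler1n => /negP[].
  rewrite lt0n size_eq0; apply/eqP => e.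
  have : [::] \in allowed_words x 0.
    by rewrite mem_allowed_words andbT; apply/allowedP; split.
  by rewrite e.
(* Only a count above 1 has a positive exponent; otherwise the dimension is at most 0. *)
have [le1|] := lerP (size (allowed_words x n))%:R (1 : R).
  apply: (@le_lt_trans _ _ 0%:E); last by rewrite ed lte_fin.
  apply: (survivor_dim_le b1 b2 hm (n := n)) => //.
  by rewrite powRr0 expr1n.
move=> /powR_root/(_ n0)[s s0 es].
apply: (@le_lt_trans _ _ s%:E).
  by apply: (survivor_dim_le b1 b2 hm (n := n)) => //; rewrite ?es // ltW.
rewrite ed lte_fin ltNge; apply/negP => /(powR_expn_le n); rewrite es.
by rewrite leNgt hn.
Qed.

Lemma bif_dimE : bif_dim beta = bif_set beta.
Proof.
apply/seteqP; split => t.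
  by move=> [ht h]; split=> // t' tt' e; apply: (h t') => //; rewrite e.
rewrite bif_setE // => st; have [ht _] := st; split=> // t' tt' e.
by have := survivor_dim_lt st tt'; rewrite e ltxx.
Qed.

Lemma survivor_dim_out t : 1 - 1 / beta <= t < 1 ->
  hausdorff_dim (survivor beta t) = 0%E.
Proof.
move=> /andP[ct t1]; rewrite -hausdorff_dim_set0; congr hausdorff_dim.
apply/seteqP; split => // x [hx hT].
have [n] := orbit_lt b1 b2 hm hx.
by rewrite ltNge (le_trans ct).
Qed.

End Drop.

(** * The multinacci equation and assembly of the theorem *)

Lemma multinacci_ones_value (R : realType) (beta : R) m :
  multinacci_root m beta -> ones_value beta m.+1 = 1.
Proof.
move=> [/andP[b1 b2] h]; have b0 : 0 < beta by apply: lt_trans b1.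
have e j : ones_value beta j * beta ^+ j = \sum_(i < j) beta ^+ i.
  elim: j => [|j IH]; first by rewrite big_ord0 ones_value0 mul0r.
  rewrite big_ord_recr /= -IH ones_valueS exprS mulrA divfK ?gt_eqF //.
  by rewrite mulrDl mul1r addrC.
have := e m.+1; rewrite -h -[RHS]mul1r => /mulIf; apply.
by rewrite expf_neq0 // gt_eqF.
Qed.

Theorem theorem1 (R : realType) (beta : R)
    (hbeta : 1 < beta <= 2) (hmult : multinacci beta) :
  [/\ bif_dim beta = bif_set beta,
      bif_set beta =
        `[0, 1 - 1 / beta[ `\` \bigcup_(I in Lyndon_intervals beta) I,
      `[0, 1 - 1 / beta[ `\` \bigcup_(I in Lyndon_intervals beta) I =
        [set t : R | 0 <= t < 1 /\
          (hausdorff_dim (bif_dim beta `&` `]t, t + r[) @[r --> 0^'+]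
             --> hausdorff_dim (survivor beta t)) /\
          (0 < hausdorff_dim (survivor beta t))%E] &
      trivIset (Lyndon_intervals beta) id].
Proof.
have [m m0 [root _]] := hmult.
have [/andP[b1 b2] _] := root.
have hm := multinacci_ones_value root.
have dimE := bif_dimE b1 b2 hm.
have setE := bif_setE b1 b2.
have selfE := self_survivorE b1 b2 m0 hm.
split => //.
- by rewrite setE selfE.
- rewrite -selfE dimE setE; apply/seteqP; split => t /=.
    move=> st; have [ht _] := st; split=> //; split; last first.
      exact: (survivor_dim_gt0 b1 b2 hm).
    apply: cvg_near_cst; near=> r.
    apply: (dim_self_survivor_near b1 b2 hm st).
    by near: r; apply: nbhs_right_gt.
  move=> [ht [cv pos]]; apply: contrapT => nst; have /andP[t0 t1] := ht.
  have [ct|tc] := leP (1 - 1 / beta) t.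
    by move: pos; rewrite (survivor_dim_out b1 b2 hm) ?ct ?ltxx.
  have [s ls ts] := Lyndon_of_return b1 b2 m0 hm t0 tc nst.
  have /= := ts; rewrite in_itv /= => /andP[tL tR].
  (* To the right of [t] its Lyndon interval contains no bifurcation point, so the limit in [cv] is
     also 0. *)
  suff e : hausdorff_dim (survivor beta t) = 0%E by rewrite e ltxx in pos.
  apply: cvg_unique cv _ => //; apply: cvg_near_cst; near=> r.
  rewrite -[RHS](hausdorff_dim_set0 R); congr hausdorff_dim.
  apply/seteqP; split => // x [/= sx]; rewrite in_itv /= => /andP[tx xr].
  have : [set x | self_survivor beta x] x by [].
  rewrite selfE => -[_]; apply.
  exists `[left_end beta s, right_end beta s[%classic => /=; last first.
    rewrite in_itv /= (le_trans tL (ltW tx)) /=; apply: lt_trans xr _.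
    by rewrite -ltrBrDl; near: r; apply: nbhs_right_lt; rewrite subr_gt0.
  exact: (Lyndon_intervals_mem b1 m0 hm).
- exact: (Lyndon_intervals_trivIset b1 b2 m0 hm).
Unshelve. all: by end_near.
Qed.
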